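(* Let $d\in\mathbb{N}$, $\varepsilon>0$, and let $f\in\Lambda$ be homogeneous of degree $2d$. Write $f$ as a polynomial in $p_1$, i.e. $f=\sum_{j=0}^{2r}f_j p_1^j$ for some $r\in\mathbb{N}_0$ and $f_0,\ldots,f_{2r}\in A_{2d}:=\mathbb{R}[p_2,p_3,\ldots,p_{2d}]$, where $f_{2r}\neq 0$. Assume that (1) $f(x)\geq\varepsilon$ for all $x\in\mathbb{R}^\infty$ with $p_2(x)=1$; and (2) $f_{2r}(x)\geq\varepsilon$ for all $x\in\mathbb{R}^\infty$ with $p_2(x)=1$. Then there exists $k\in\mathbb{N}_0$ such that $p_2^k f$ is an any-dimensional sum of squares.
   Context: $\mathbb{N}$ denotes the positive integers and $\mathbb{N}_0=\mathbb{N}\cup\{0\}$. For $k\geq 1$ let $p_k=\sum_{i=1}^\infty X_i^k$ be the $k$-th power sum function in countably many variables $X_1,X_2,\ldots$; the $p_k$ are algebraically independent and $p_k$ is homogeneous of degree $k$ in the $X_i$. $\Lambda=\mathbb{R}[p_1,p_2,\ldots]$ is the ring of symmetric functions. For $f\in\Lambda$, $f^{(n)}=f(X_1,\ldots,X_n,0,0,\ldots)\in\mathbb{R}[X_1,\ldots,X_n]$ denotes its truncation to $n$ variables. $\mathbb{R}^\infty$ is the set of real sequences with only finitely many non-zero entries. A symmetric function $g$ is an any-dimensional sum of squares if, for every $n\in\mathbb{N}$, $g^{(n)}$ is a sum of squares of polynomials in $\mathbb{R}[X_1,\ldots,X_n]$. *)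

(* Defs.v *)
From HB Require Import structures.
From mathcomp Require Import all_boot all_order all_algebra.
From mathcomp Require Import finmap.
From mathcomp Require Import reals.
From mathcomp.multinomials Require Import monalg.
From mathcomp.multinomials Require Import mpoly.

Set Implicit Arguments.
Unset Strict Implicit.
Unset Printing Implicit Defensive.

Import GRing.Theory Num.Theory.
Local Open Scope ring_scope.

(* Both files above define this notation; the polynomials of mpoly.v are meant. *)
Notation "{ 'mpoly' R [ n ] }" := (mpoly.mpoly n R) : type_scope.

(* [Lambda R] is R[p_1, p_2, ...]: since the power sums are algebraically
   independent, it is the polynomial ring on countably many generators.
   The generator of index [i : nat] is p_(i+1), so that the monomial [m]
   stands for the product of the p_(i+1) ^+ m i. *)
Notation Lambda R := {malg R[{cmonom nat}]}.

(* The power sum p_k, for k >= 1 only ([psum R 0] is a dummy value). *)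
Definition psum (R : realType) (k : nat) : Lambda R := << ucm k.-1 >>.

(* Substitution of [q k] for p_k (k >= 1), scalars being mapped by [iota]. *)
Definition psubst (R : realType) (S : comNzRingType) (iota : R -> S)
    (q : nat -> S) (f : Lambda R) : S :=
  monalg.mmap iota
    (fun m : {cmonom nat} => \prod_(i <- finsupp m) q i.+1 ^+ m i) f.

Definition trunc (R : realType) (n : nat) (f : Lambda R) : {mpoly R[n]} :=
  psubst (@mpolyC n R) (fun k => \sum_(i < n) 'X_i ^+ k) f.

(* Finitely supported sequences: the set R^oo of points at which symmetric
   functions are evaluated. *)
Definition Rinfty (R : realType) := {fsfun nat -> R with 0}.

Definition sym_eval (R : realType) (x : Rinfty R) (f : Lambda R) : R :=
  psubst idfun (fun k => \sum_(i <- finsupp x) x i ^+ k) f.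

(* Homogeneity with respect to the variables X_1, X_2, ... (each p_k has
   degree k), not with respect to the p_k. *)
Definition sym_homog (R : realType) (e : nat) (f : Lambda R) : Prop :=
  forall n : nat, trunc n f \is e.-homog.

(* The subalgebra R[p_2, ..., p_m] *)
Definition in_A (R : realType) (m : nat) (f : Lambda R) : Prop :=
  forall u, u \in monalg.msupp f ->
  forall i, i \in finsupp u -> (2 <= i.+1 <= m)%N.

Definition is_sos (R : realType) (n : nat) (g : {mpoly R[n]}) : Prop :=
  exists s : seq {mpoly R[n]}, g = \sum_(h <- s) h ^+ 2.

Definition anydim_sos (R : realType) (g : Lambda R) : Prop :=
  forall n : nat, (0 < n)%N -> is_sos (trunc n g).

(* Main.v *)
Require Import Defs.
From HB Require Import structures.
From mathcomp Require Import all_boot all_order all_algebra.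
From mathcomp Require Import finmap.
From mathcomp Require Import boolp reals.
From mathcomp Require Import complex polyrcf.
From mathcomp.multinomials Require Import monalg.
From mathcomp.multinomials Require Import mpoly.
From mathcomp Require Import ring lra zify.

(** Everything takes place on the unit spheres p_2 = 1 of all the spaces R^n
    simultaneously: it is enough to write f there as a sum of squares of
    polynomials whose degree is bounded independently of n, because
    homogenizing such a representation with the help of p_2 multiplies f by a
    power of p_2 which depends on the degree only (lemma [homogenize]).

    The first step is local.  Let y be a point of the sphere, let b_v be numbers
    of the same sign as the y_v, and measure the distance from X to y by the
    penalty, the sum of the (X_v^2 - y_v^2)^2 + (X_v^3 - b_v)^2.  A small
    penalty makes p_k(X) close to p_k(y) for k >= 3, and this has a certificate
    which is uniform in n: for every c > 0 there is a constant C such that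
    C penalty + c - (p_k(X) - p_k(y))^2 is a sum of squares
    ([power_sum_local]).  The same then holds for the coefficients f_j, which
    do not involve p_1.  The variable p_1 itself is unbounded, and in effect
    independent of the others: adding many tiny coordinates to y moves p_1 to
    any prescribed value and hardly changes the other power sums, so that
    the lower bound on f gives f_y(t) = sum_j f_j(y) t^j >= eps for all real t
    ([free_p1_lower_bound]).  As the leading coefficient f_2r is bounded from
    below as well, f_y(t) - eta W(t), where W(t) = 1 + t^2 + ... + t^(2r), is
    positive for some eta > 0 which does not depend on y and n
    ([even_powers_margin]); it is therefore a sum of two squares of polynomials
    in t ([poly_pos_two_squares]).  Substituting p_1 for t and replacing f_j(y)
    by f_j(X), one gets that f - eta/2 W + M W penalty is a sum of squares
    ([cone_local]).

    The second step eliminates the penalty by averaging over y.  Draw an index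
    v with probability X_v^2, and then a sign s with probability (1 + s X_v)/2.
    These probabilities are sums of squares with sum 1, and the indicator of v
    and its product with s have the means X_v^2 and X_v^3.  Take for y_v^2 and
    b_v the empirical means of K independent draws: b_v has the sign of y_v for
    a suitable choice of the sign of y_v, the point y lies on the sphere, and
    the expected penalty is at most 2/K.  Averaging the local certificates over
    all the outcomes hence shows that f - eta/2 W + 2 M/K W is a sum of squares
    ([sampling]), and f is one as soon as K >= 4 M/eta. *)

Set Implicit Arguments.
Unset Strict Implicit.
Unset Printing Implicit Defensive.

Import Order.TTheory GRing.Theory Num.Theory.
Local Open Scope ring_scope.

Local Notation "{ 'mpoly' R [ n ] }" := (mpoly.mpoly n R) : type_scope.

(** * Sums of squares on the unit spheres, uniformly in the dimension *)

Section SphereCone.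
Variable R : realType.

(** Points are infinite sequences, of which only the first [n] entries count:
    the type of points does not depend on the dimension, which will vary. *)
Definition restr n (X : nat -> R) : 'I_n -> R := fun v => X v.

Definition on_sphere n (X : nat -> R) := \sum_(v < n) X v ^+ 2 = 1.

(** Polynomial functions on the sphere, graded by a level instead of the degree:
    since p_2 = 1, every polynomial coincides on the sphere with the sum of
    two forms of consecutive degrees. *)
Definition sphere_pol n e (u : (nat -> R) -> R) :=
  exists E O : {mpoly R[n]}, [/\ E \is e.+1.-homog, O \is e.-homog &
    forall X, on_sphere n X -> u X = E.@[restr X] + O.@[restr X]].

Definition sphere_sos n e (g : (nat -> R) -> R) :=
  exists s : seq ({mpoly R[n]} * {mpoly R[n]}),
    (forall q, q \in s -> q.1 \is e.+1.-homog /\ q.2 \is e.-homog) /\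
    forall X, on_sphere n X ->
      g X = \sum_(q <- s) (q.1.@[restr X] + q.2.@[restr X]) ^+ 2.

Definition mpsum2 n : {mpoly R[n]} := \sum_(v < n) 'X_v ^+ 2.

Lemma dhomogXU n (v : 'I_n) : ('X_v : {mpoly R[n]}) \is 1.-homog.
Proof. by rewrite dhomogX; apply/eqP; exact: mdeg1. Qed.

Lemma mpsum2_homog n : mpsum2 n \is 2.-homog.
Proof.
apply: rpred_sum => v _; have := dhomogMn 2 (dhomogXU v).
by rewrite mul1n.
Qed.

Lemma meval_mpsum2 n X : (mpsum2 n).@[restr X] = \sum_(v < n) X v ^+ 2.
Proof.
rewrite /mpsum2 raddf_sum; apply: eq_bigr => v _.
by rewrite /= expr2 mevalM mevalXU.
Qed.

Lemma sphere_pol_ext n e u v :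
  (forall X, on_sphere n X -> u X = v X) -> sphere_pol n e v -> sphere_pol n e u.
Proof.
move=> uv [E [O [hE hO h]]]; exists E, O; split=> // X hX.
by rewrite uv // h.
Qed.

Lemma sphere_polS n e u : sphere_pol n e u -> sphere_pol n e.+1 u.
Proof.
move=> [E [O [hE hO h]]]; exists (mpsum2 n * O), E; split=> //.
  exact: dhomogM (mpsum2_homog n) hO.
by move=> X hX; rewrite h // mevalM meval_mpsum2 hX mul1r addrC.
Qed.

Lemma sphere_pol_mono n e e' u : (e <= e')%N -> sphere_pol n e u -> sphere_pol n e' u.
Proof.
move=> /subnK <-; elim: (e' - e)%N => [//|k IH] /IH.
exact: sphere_polS.
Qed.

Lemma sphere_polD n e u v : sphere_pol n e u -> sphere_pol n e v ->
  sphere_pol n e (fun X => u X + v X).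
Proof.
move=> [E [O [hE hO h]]] [E' [O' [hE' hO' h']]].
exists (E + E'), (O + O'); split; try exact: rpredD.
by move=> X hX; rewrite h // h' // !mevalD addrACA.
Qed.

Lemma sphere_polM n e e' u v : sphere_pol n e u -> sphere_pol n e' v ->
  sphere_pol n (e + e').+1 (fun X => u X * v X).
Proof.
move=> [E [O [hE hO h]]] [E' [O' [hE' hO' h']]].
exists (E * E' + mpsum2 n * (O * O')), (E * O' + O * E'); split.
- apply: rpredD; first by have := dhomogM hE hE'; rewrite addSn addnS.
  by have := dhomogM (mpsum2_homog n) (dhomogM hO hO'); rewrite addSn add1n.
- apply: rpredD; first by have := dhomogM hE hO'; rewrite addSn.
  by have := dhomogM hO hE'; rewrite addnS.
- move=> X hX; rewrite h // h' // !(mevalD, mevalM) meval_mpsum2 hX; ring.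
Qed.

Lemma sphere_pol_cst n c : sphere_pol n 0 (fun=> c).
Proof.
exists 0, c%:MP; split; first exact: dhomog0.
  rewrite -[c]mulr1 mpolyCM mul_mpolyC; exact: dhomogZ (dhomog1 _ _).
by move=> X _; rewrite meval0 mevalC add0r.
Qed.

Lemma sphere_pol_coord n v : (v < n)%N -> sphere_pol n 0 (fun X => X v).
Proof.
move=> vn; exists 'X_(Ordinal vn), 0; split; [exact: dhomogXU|exact: dhomog0|].
by move=> X _; rewrite mevalXU meval0 addr0.
Qed.

Lemma sphere_sos_ext n e g h :
  (forall X, on_sphere n X -> g X = h X) -> sphere_sos n e h -> sphere_sos n e g.
Proof.
move=> gh [s [hs h1]]; exists s; split=> // X hX.
by rewrite gh // h1.
Qed.

Lemma sphere_sos0 n e : sphere_sos n e (fun=> 0).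
Proof. by exists [::]; split=> // X _; rewrite big_nil. Qed.

Lemma sphere_sosD n e g h : sphere_sos n e g -> sphere_sos n e h ->
  sphere_sos n e (fun X => g X + h X).
Proof.
move=> [s [hs h1]] [s' [hs' h1']]; exists (s ++ s'); split.
  by move=> q; rewrite mem_cat => /orP[/hs|/hs'].
by move=> X hX; rewrite h1 // h1' // big_cat.
Qed.

Lemma sphere_sos_sq n e u : sphere_pol n e u -> sphere_sos n e (fun X => u X ^+ 2).
Proof.
move=> [E [O [hE hO h]]]; exists [:: (E, O)]; split.
  by move=> q; rewrite inE => /eqP->.
by move=> X hX; rewrite big_seq1 h.
Qed.

Lemma sphere_sos_sum n e (T : eqType) (s : seq T) (P : pred T)
    (G : T -> (nat -> R) -> R) :
  (forall t, t \in s -> P t -> sphere_sos n e (G t)) ->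
  sphere_sos n e (fun X => \sum_(t <- s | P t) G t X).
Proof.
elim: s => [|t s IH] hs.
  by apply: sphere_sos_ext (sphere_sos0 n e) => X _; rewrite big_nil.
have {}IH := IH (fun u us => hs u (mem_behead (s := t :: s) us)).
case Pt: (P t).
  apply: sphere_sos_ext (sphere_sosD (hs t _ Pt) IH); rewrite ?mem_head // => X _.
  by rewrite big_cons Pt.
by apply: sphere_sos_ext IH => X _; rewrite big_cons Pt.
Qed.

Lemma sphere_sos_ind n e (P : ((nat -> R) -> R) -> Prop) g :
  (forall g h, (forall X, on_sphere n X -> g X = h X) -> P h -> P g) ->
  P (fun=> 0) ->
  (forall u h, sphere_pol n e u -> P h -> P (fun X => u X ^+ 2 + h X)) ->
  sphere_sos n e g -> P g.
Proof.
move=> Pext P0 PD [s [hs hg]]; apply: (Pext _ _ hg) => {g hg}.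
elim: s hs => [|q s IH] hs.
  by apply: (Pext _ (fun=> 0)) => // X _; rewrite big_nil.
apply: (Pext _ _ _ (PD (fun X => q.1.@[restr X] + q.2.@[restr X]) _ _ (IH _))).
- by move=> X _; rewrite big_cons.
- have [h1 h2] := hs q (mem_head _ _).
  by exists q.1, q.2; split.
- by move=> q' hq'; apply: hs; rewrite inE hq' orbT.
Qed.

Lemma sphere_sos_mono n e e' g : (e <= e')%N -> sphere_sos n e g -> sphere_sos n e' g.
Proof.
move=> le; apply: sphere_sos_ind => [u v uv|| u h hu hh].
- exact: sphere_sos_ext uv.
- exact: sphere_sos0.
- exact: sphere_sosD (sphere_sos_sq (sphere_pol_mono le hu)) hh.
Qed.

Lemma sphere_sosM n e e' g h : sphere_sos n e g -> sphere_sos n e' h ->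
  sphere_sos n (e + e').+1 (fun X => g X * h X).
Proof.
move=> hg hh; move: hg.
apply: (sphere_sos_ind (P := fun g => sphere_sos n (e + e').+1 (fun X => g X * h X)))
  => [u v uv|| u g' hu hg'].
- by apply: sphere_sos_ext => X hX; rewrite uv.
- by apply: sphere_sos_ext (sphere_sos0 _ _) => X hX; rewrite mul0r.
suff hu2 : sphere_sos n (e + e').+1 (fun X => u X ^+ 2 * h X).
  by apply: sphere_sos_ext (sphere_sosD hu2 hg') => X _; rewrite mulrDl.
move: hh.
apply: (sphere_sos_ind (P := fun h => sphere_sos n (e + e').+1 (fun X => u X ^+ 2 * h X)))
  => [v w vw|| v h' hv hh'].
- by apply: sphere_sos_ext => X hX; rewrite vw.
- by apply: sphere_sos_ext (sphere_sos0 _ _) => X hX; rewrite mulr0.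
- apply: sphere_sos_ext (sphere_sosD (sphere_sos_sq (sphere_polM hu hv)) hh') => X _.
  by rewrite mulrDr exprMn.
Qed.

Lemma sphere_sos_ge0 n e g X : sphere_sos n e g -> on_sphere n X -> 0 <= g X.
Proof.
by move=> [s [_ hg]] hX; rewrite hg //; apply: sumr_ge0 => q _; exact: sqr_ge0.
Qed.

End SphereCone.

Arguments restr {R n}.

Section Families.
Variables (R : realType) (I : Type) (N : I -> nat).
Local Notation fam := (I -> (nat -> R) -> R).
Implicit Types g h u v : fam.

(** Families of functions, where the dimension [N i] depends on the index. What
    matters is that the level is the same for the whole family. *)
Definition pol u := exists e, forall i, sphere_pol (N i) e (u i).
Definition cone g := exists e, forall i, sphere_sos (N i) e (g i).

Lemma pol_ext u v :
  (forall i X, on_sphere (N i) X -> u i X = v i X) -> pol v -> pol u.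
Proof. by move=> uv [e h]; exists e => i; apply: sphere_pol_ext (h i); apply: uv. Qed.

Lemma pol_cst (c : I -> R) : pol (fun i _ => c i).
Proof. by exists 0%N => i; apply: sphere_pol_cst. Qed.

Lemma pol_coord (v : I -> nat) :
  (forall i, v i < N i)%N -> pol (fun i X => X (v i)).
Proof. by move=> hv; exists 0%N => i; apply: sphere_pol_coord. Qed.

Lemma polD u v : pol u -> pol v -> pol (fun i X => u i X + v i X).
Proof.
move=> [e h] [e' h']; exists (maxn e e') => i; apply: sphere_polD.
  exact: sphere_pol_mono (leq_maxl _ _) (h i).
exact: sphere_pol_mono (leq_maxr _ _) (h' i).
Qed.

Lemma polM u v : pol u -> pol v -> pol (fun i X => u i X * v i X).
Proof. by move=> [e h] [e' h']; exists (e + e').+1 => i; apply: sphere_polM. Qed.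

Lemma polN u : pol u -> pol (fun i X => - u i X).
Proof.
move=> hu; apply: pol_ext (polM (pol_cst (fun=> -1)) hu) => i X _.
by rewrite mulN1r.
Qed.

Lemma polB u v : pol u -> pol v -> pol (fun i X => u i X - v i X).
Proof. by move=> hu hv; exact: polD hu (polN hv). Qed.

Lemma polX u k : pol u -> pol (fun i X => u i X ^+ k).
Proof.
move=> hu; elim: k => [|k IH]; first exact: (pol_cst (fun=> 1)).
by apply: pol_ext (polM hu IH) => i X _; rewrite exprS.
Qed.

Lemma cone_ext g h :
  (forall i X, on_sphere (N i) X -> g i X = h i X) -> cone h -> cone g.
Proof. by move=> uv [e k]; exists e => i; apply: sphere_sos_ext (k i); apply: uv. Qed.

Lemma coneD g h : cone g -> cone h -> cone (fun i X => g i X + h i X).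
Proof.
move=> [e hg] [e' hh]; exists (maxn e e') => i; apply: sphere_sosD.
  exact: sphere_sos_mono (leq_maxl _ _) (hg i).
exact: sphere_sos_mono (leq_maxr _ _) (hh i).
Qed.

Lemma coneM g h : cone g -> cone h -> cone (fun i X => g i X * h i X).
Proof. by move=> [e k] [e' k']; exists (e + e').+1 => i; apply: sphere_sosM. Qed.

Lemma cone_sq u : pol u -> cone (fun i X => u i X ^+ 2).
Proof. by move=> [e h]; exists e => i; apply: sphere_sos_sq. Qed.

Lemma cone_cst (c : I -> R) : (forall i, 0 <= c i) -> cone (fun i _ => c i).
Proof.
move=> c0; apply: cone_ext (cone_sq (pol_cst (fun i => Num.sqrt (c i)))).
by move=> i X _; rewrite sqr_sqrtr.
Qed.

Lemma coneZ (c : I -> R) g : (forall i, 0 <= c i) -> cone g ->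
  cone (fun i X => c i * g i X).
Proof. by move=> c0; apply: coneM; apply: cone_cst. Qed.

Lemma cone_ge0 g i X : cone g -> on_sphere (N i) X -> 0 <= g i X.
Proof. by move=> [e h]; apply: sphere_sos_ge0. Qed.

End Families.

Section Reindex.
Variable R : realType.

Lemma pol_reindex (I J : Type) (N : I -> nat) (p : J -> I)
    (u : I -> (nat -> R) -> R) :
  pol N u -> pol (fun j => N (p j)) (fun j => u (p j)).
Proof. by move=> [e h]; exists e => j. Qed.

Lemma cone_reindex (I J : Type) (N : I -> nat) (p : J -> I)
    (g : I -> (nat -> R) -> R) :
  cone N g -> cone (fun j => N (p j)) (fun j => g (p j)).
Proof. by move=> [e h]; exists e => j. Qed.

(** The number [m i] of summands may vary with [i]: what has to be uniform is
    the level of all the summands together. *)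
Lemma cone_sum (I : Type) (N m : I -> nat) (G : I -> nat -> (nat -> R) -> R) :
  cone (fun j : {p : I * nat | (p.2 < m p.1)%N} => N (sval j).1)
    (fun j => G (sval j).1 (sval j).2) ->
  cone N (fun i X => \sum_(k < m i) G i k X).
Proof.
move=> [e h]; exists e => i; apply: sphere_sos_sum => k _ _.
exact: (h (exist _ (i, val k) (ltn_ord k))).
Qed.

Lemma sphere_pol_sum n e m (G : nat -> (nat -> R) -> R) :
  (forall k, (k < m)%N -> sphere_pol n e (G k)) ->
  sphere_pol n e (fun X => \sum_(k < m) G k X).
Proof.
elim: m => [|m IH] h.
  apply: sphere_pol_ext (sphere_pol_mono (leq0n e) (sphere_pol_cst n 0)) => X _.
  by rewrite big_ord0.
apply: sphere_pol_ext (sphere_polD (IH (fun k km => h k (ltnW km))) (h m (ltnSn m))).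
by move=> X _; rewrite big_ord_recr.
Qed.

Lemma pol_sum (I : Type) (N m : I -> nat) (G : I -> nat -> (nat -> R) -> R) :
  pol (fun j : {p : I * nat | (p.2 < m p.1)%N} => N (sval j).1)
    (fun j => G (sval j).1 (sval j).2) ->
  pol N (fun i X => \sum_(k < m i) G i k X).
Proof.
move=> [e h]; exists e => i; apply: sphere_pol_sum => k km.
exact: (h (exist _ (i, k) km)).
Qed.

End Reindex.

(** * Certificates in one coordinate *)

Ltac pol_tac := repeat first
  [ assumption | exact: pol_cst | apply: polX | apply: polB | apply: polD
  | apply: polM | apply: polN ].

Section OneCoordinate.
Variables (R : realType) (I : Type) (N v : I -> nat) (y b : I -> R).
Hypothesis vN : forall i, (v i < N i)%N.
Hypothesis y1 : forall i, y i ^+ 2 <= 1.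
Hypothesis by0 : forall i, 0 <= b i * y i.
Local Notation x := (fun (i : I) (X : nat -> R) => X (v i)).

Let pol_x : pol N x. Proof. exact: pol_coord. Qed.

(** On the sphere, [1 - x ^+ 2] is the sum of the squares of the other
    coordinates. *)
Lemma cone_coord_le1 : cone N (fun i X => 1 - x i X ^+ 2).
Proof.
have h : cone N (fun i (X : nat -> R) => \sum_(u < N i) ((u != v i :> nat)%:R * X u ^+ 2)).
  apply: (cone_sum (G := fun i u (X : nat -> R) => (u != v i :> nat)%:R * X u ^+ 2)).
  apply: (coneZ (c := fun j => ((sval j).2 != v (sval j).1 :> nat)%:R)).
    by move=> j; apply: ler0n.
  by apply: cone_sq; apply: pol_coord => -[[i u] /=].
apply: cone_ext h => i X hX; rewrite -[Z in Z - _]hX (bigD1 (Ordinal (vN i))) //=.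
rewrite [RHS](bigD1 (Ordinal (vN i))) //= eqxx mul0r add0r addrAC subrr add0r.
apply: eq_bigr => u uv.
by rewrite (_ : (u != v i :> nat)) ?mul1r.
Qed.

Lemma cone_coord_pow_le1 k : cone N (fun i X => 1 - x i X ^+ (2 * k)).
Proof.
elim: k => [|k IH].
  apply: cone_ext (cone_cst (c := fun=> 0) _ _) => // i X _.
  by rewrite muln0 expr0 subrr.
apply: cone_ext (coneD IH (coneM (cone_sq (polX k pol_x)) cone_coord_le1)).
move=> i X _; rewrite mulnS exprD mulnC exprM; ring.
Qed.

(** With [P := x ^+ 3 - b], [Q := x ^+ 2 - y ^+ 2] and
    [u := x * y ^+ 2 - b = P - x * Q], one has
    [(x - y) * (b + y ^+ 3) = y ^+ 2 * Q - u * (x - y)], which is small with [P]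
    and [Q], while [(b + y ^+ 3) ^+ 2 >= y ^+ 6] as [b] has the sign of [y].
    This is the place where the cubes decide between [y] and [- y]. *)
Lemma one_coordinate_weak :
  cone N (fun i X => 18%:R * ((x i X ^+ 2 - y i ^+ 2) ^+ 2 + (x i X ^+ 3 - b i) ^+ 2)
    - (x i X - y i) ^+ 2 * y i ^+ 6).
Proof.
have h1 : cone N (fun i X => ((b i + y i ^+ 3) ^+ 2 - y i ^+ 6) * (x i X - y i) ^+ 2).
  apply: coneZ => [i|]; last by apply: cone_sq; pol_tac.
  have -> : (b i + y i ^+ 3) ^+ 2 - y i ^+ 6 = b i ^+ 2 + 2 * (b i * y i) * y i ^+ 2.
    ring.
  rewrite addr_ge0 ?sqr_ge0 // mulr_ge0 ?sqr_ge0 // mulr_ge0 //.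
have h2 : cone N (fun i X => (y i ^+ 2 * (x i X ^+ 2 - y i ^+ 2) +
    (x i X * y i ^+ 2 - b i) * (x i X - y i)) ^+ 2).
  by apply: cone_sq; pol_tac.
have h3 : cone N (fun i X => 2 * ((x i X * y i ^+ 2 - b i) ^+ 2 *
    ((x i X + y i) ^+ 2 + (2 * (1 - x i X ^+ 2) + 2 * (1 - y i ^+ 2))))).
  apply: (coneZ (c := fun=> 2)) => //; apply: coneM.
    by apply: cone_sq; pol_tac.
  apply: coneD; first by apply: cone_sq; pol_tac.
  apply: coneD.
    exact: (coneZ (c := fun=> 2) _ cone_coord_le1).
  by apply: cone_cst => i; rewrite mulr_ge0 // subr_ge0.
have h4 : cone N (fun i X => 8%:R * ((x i X ^+ 3 - b i) + x i X * (x i X ^+ 2 - y i ^+ 2)) ^+ 2).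
  by apply: (coneZ (c := fun=> 8%:R)) => [i|]; [exact: ler0n|apply: cone_sq; pol_tac].
have h5 : cone N (fun i X => 16%:R * ((1 - x i X ^+ 2) * (x i X ^+ 2 - y i ^+ 2) ^+ 2)).
  apply: (coneZ (c := fun=> 16%:R)) => [i|]; first exact: ler0n.
  by apply: (coneM cone_coord_le1); apply: cone_sq; pol_tac.
have h6 : cone N (fun i X => (2 * (1 - y i ^+ 4)) * (x i X ^+ 2 - y i ^+ 2) ^+ 2).
  apply: coneZ => [i|]; last by apply: cone_sq; pol_tac.
  rewrite mulr_ge0 // subr_ge0 (_ : y i ^+ 4 = (y i ^+ 2) ^+ 2); last by rewrite -exprM.
  by rewrite expr_le1 // sqr_ge0.
have h7 : cone N (fun i X => 2 * (x i X ^+ 3 - b i) ^+ 2).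
  by apply: (coneZ (c := fun=> 2)) => //; apply: cone_sq; pol_tac.
apply: cone_ext (coneD h1 (coneD h2 (coneD h3 (coneD h4 (coneD h5 (coneD h6 h7)))))).
move=> i X _; ring.
Qed.

(** The factor [y ^+ 6] of the previous lemma is useless for small [y]; there one
    uses that [(x - y) ^+ 2 <= 2 * (x ^+ 2 + y ^+ 2)], the right-hand side
    having a bounded sum over all the coordinates. *)
Lemma one_coordinate (c : R) : 0 < c -> exists2 C : R, 0 <= C &
  cone N (fun i X =>
    C * ((x i X ^+ 2 - y i ^+ 2) ^+ 2 + (x i X ^+ 3 - b i) ^+ 2)
    + c * (x i X ^+ 2 + y i ^+ 2)
    - (x i X - y i) ^+ 2 * (x i X ^+ 2 + y i ^+ 2)).
Proof.
(* [K] is such that [y ^+ 2 <= K * y ^+ 6 + c / 6]. *)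
move=> c0; pose K := (c / 6%:R) ^- 2.
have K0 : 0 <= K by rewrite invr_ge0 sqr_ge0.
exists (2 + 54%:R * K); first by rewrite addr_ge0 // mulr_ge0.
have Kb i : 0 <= 3%:R * (K * y i ^+ 6 + c / 6%:R - y i ^+ 2).
  rewrite mulr_ge0 //; set g := c / 6%:R.
  have g0 : 0 < g by rewrite divr_gt0.
  have -> : K * y i ^+ 6 + g - y i ^+ 2 =
      g * ((y i ^+ 2 / g) ^+ 3 - y i ^+ 2 / g + 1).
    by rewrite /K -/g; field; rewrite gt_eqF.
  apply: mulr_ge0; [exact: ltW|set w := _ / g].
  have w0 : 0 <= w by apply: divr_ge0; [exact: sqr_ge0|exact: ltW].
  have -> : w ^+ 3 - w + 1 = (w - 1) ^+ 2 * (w + 1) + w ^+ 2 by ring.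
  apply: addr_ge0; last exact: sqr_ge0.
  by apply: mulr_ge0; [exact: sqr_ge0|exact: addr_ge0].
have h1 : cone N (fun i X => ((x i X - y i) * (x i X + 2 * y i)) ^+ 2).
  by apply: cone_sq; pol_tac.
have h2 : cone N (fun i X => 3%:R * (K * y i ^+ 6 + c / 6%:R - y i ^+ 2) *
    (x i X - y i) ^+ 2).
  by apply: coneZ => //; apply: cone_sq; pol_tac.
have h3 : cone N (fun i X => c / 2 * (x i X + y i) ^+ 2).
  apply: (coneZ (c := fun=> c / 2)) => [i|]; first by rewrite divr_ge0 // ltW.
  by apply: cone_sq; pol_tac.
have h4 := coneZ (c := fun=> 3%:R * K) (fun=> mulr_ge0 (ler0n _ 3) K0) one_coordinate_weak.
have h5 : cone N (fun i X => 2 * (x i X ^+ 3 - b i) ^+ 2).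
  by apply: (coneZ (c := fun=> 2)) => //; apply: cone_sq; pol_tac.
apply: cone_ext (coneD h1 (coneD h2 (coneD h3 (coneD h4 h5)))).
by move=> i X _; field.
Qed.

Lemma pow_coordinate k : exists2 C : R, 0 <= C &
  cone N (fun i X => C * ((x i X - y i) ^+ 2 * (x i X ^+ 2 + y i ^+ 2))
    - (x i X ^+ k.+2 - y i ^+ k.+2) ^+ 2).
Proof.
elim: k => [|k [C C0 IH]].
  exists 2 => //.
  have h : cone N (fun i X => ((x i X - y i) ^+ 2) ^+ 2).
    by apply: cone_sq; pol_tac.
  by apply: cone_ext h => i X _; ring.
exists (2 * C + 2); first by rewrite addr_ge0 // mulr_ge0.
have h1 : cone N (fun i X => (x i X * (x i X ^+ k.+2 - y i ^+ k.+2)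
    - y i ^+ k.+2 * (x i X - y i)) ^+ 2).
  by apply: cone_sq; pol_tac.
have h2 : cone N (fun i X => 2 * ((1 - x i X ^+ 2) * (x i X ^+ k.+2 - y i ^+ k.+2) ^+ 2)).
  apply: (coneZ (c := fun=> 2)) => //; apply: (coneM cone_coord_le1).
  by apply: cone_sq; pol_tac.
have h3 := coneZ (c := fun=> 2) (fun=> ler0n _ 2) IH.
have h4 : cone N (fun i X => 2 * ((x i X - y i) ^+ 2 *
    (x i X ^+ 2 + y i ^+ 2 * (1 - (y i ^+ 2) ^+ k.+1)))).
  apply: (coneZ (c := fun=> 2)) => //; apply: coneM; first by apply: cone_sq; pol_tac.
  apply: coneD; first by apply: cone_sq; pol_tac.
  apply: cone_cst => i; rewrite mulr_ge0 ?sqr_ge0 // subr_ge0.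
  by rewrite exprn_ile1 // sqr_ge0.
apply: cone_ext (coneD h1 (coneD h2 (coneD h3 h4))) => i X _.
rewrite -exprM mulnC exprM !(exprS _ k.+2) !(exprS _ k.+1); ring.
Qed.

End OneCoordinate.

(** * Certificates for power sums *)

Definition pws (R : realType) n (X : nat -> R) k := \sum_(v < n) X v ^+ k.

(** A squared distance from [X] to the data [y], [b]: the squares of the
    coordinates determine a point up to signs, and the cubes give the signs. *)
Definition penalty (R : realType) n (y b X : nat -> R) :=
  \sum_(v < n) ((X v ^+ 2 - y v ^+ 2) ^+ 2 + (X v ^+ 3 - b v) ^+ 2).

Notation coords N := {p : _ * nat | (p.2 < N p.1)%N}.

Section Local.
Variables (R : realType) (I : Type) (N : I -> nat) (y b : I -> nat -> R).
Hypothesis y_sphere : forall i, on_sphere (N i) (y i).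
Hypothesis by_ge0 : forall i v, (v < N i)%N -> 0 <= b i v * y i v.

Local Notation NJ := (fun j : coords N => N (sval j).1).
Local Notation yJ := (fun j : coords N => y (sval j).1 (sval j).2).
Local Notation bJ := (fun j : coords N => b (sval j).1 (sval j).2).
Local Notation xJ := (fun (j : coords N) (X : nat -> R) => X (sval j).2).

Let ltJ (j : coords N) : ((sval j).2 < NJ j)%N. Proof. exact: (svalP j). Qed.

Lemma sphere_coord_le1 n (X : nat -> R) v :
  on_sphere n X -> (v < n)%N -> X v ^+ 2 <= 1.
Proof.
move=> hX vn; rewrite -hX (bigD1 (Ordinal vn)) //= lerDl.
by apply: sumr_ge0 => u _; exact: sqr_ge0.
Qed.

Let y1 (j : coords N) : yJ j ^+ 2 <= 1.
Proof. exact: sphere_coord_le1 (y_sphere _) (ltJ j). Qed.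

Let by0 (j : coords N) : 0 <= bJ j * yJ j.
Proof. exact: by_ge0 (ltJ j). Qed.

Let polx : pol NJ xJ. Proof. exact: pol_coord ltJ. Qed.

(** The Cauchy-Schwarz inequality for a unit vector [A]: with [c] the scalar
    product of [A] and [B], the difference is the square of the norm of
    [B - c A]. *)
Lemma cone_cauchy (A B : I -> nat -> (nat -> R) -> R) :
  pol NJ (fun j => A (sval j).1 (sval j).2) ->
  pol NJ (fun j => B (sval j).1 (sval j).2) ->
  (forall i X, on_sphere (N i) X -> \sum_(v < N i) A i v X ^+ 2 = 1) ->
  cone N (fun i X => \sum_(v < N i) B i v X ^+ 2
    - (\sum_(v < N i) A i v X * B i v X) ^+ 2).
Proof.
move=> hA hB A1; pose c i X := \sum_(v < N i) A i v X * B i v X.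
have hc : pol N c.
  apply: (pol_sum (G := fun i v X => A i v X * B i v X)); exact: polM.
have h : cone N (fun i X => \sum_(v < N i) (B i v X - c i X * A i v X) ^+ 2).
  apply: (cone_sum (G := fun i v X => (B i v X - c i X * A i v X) ^+ 2)).
  apply: cone_sq; apply: polB => //; apply: polM => //.
  exact: (pol_reindex (fun j : coords N => (sval j).1) hc).
apply: cone_ext h => i X hX.
rewrite [RHS](eq_bigr (fun v : 'I_(N i) => B i v X ^+ 2 + ((- (2 * c i X)) * (A i v X * B i v X)
  + c i X ^+ 2 * A i v X ^+ 2))); last by move=> v _; ring.
rewrite !big_split /= -!mulr_sumr A1 // -/(c i X); ring.
Qed.

Lemma local_sum (c : R) : 0 < c -> exists2 C : R, 0 <= C &
  cone N (fun i X => C * penalty (N i) (y i) (b i) X + c -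
    \sum_(v < N i) (X v - y i v) ^+ 2 * (X v ^+ 2 + y i v ^+ 2)).
Proof.
move=> c0; have [|C C0 h] := one_coordinate ltJ y1 by0 (c := c / 2).
  by rewrite divr_gt0.
exists C => //; apply: cone_ext (cone_sum (G := fun i v X =>
  C * ((X v ^+ 2 - y i v ^+ 2) ^+ 2 + (X v ^+ 3 - b i v) ^+ 2)
    + c / 2 * (X v ^+ 2 + y i v ^+ 2)
    - (X v - y i v) ^+ 2 * (X v ^+ 2 + y i v ^+ 2)) h) => i X hX.
rewrite sumrB big_split /= -!mulr_sumr -/(penalty _ _ _ _) big_split /=.
by rewrite hX y_sphere; congr (_ + _ - _); field.
Qed.

(** The differences of powers split as
    [x ^+ k.+3 - y ^+ k.+3 = x * (x ^+ k.+2 - y ^+ k.+2) + y * (y ^+ k.+1 * (x - y))],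
    so that the Cauchy-Schwarz inequality applies with the unit vectors [X] and
    [y]. The exponent has to be at least 3: the squares of
    the remaining factors must be bounded by a multiple of
    [(x - y) ^+ 2 * (x ^+ 2 + y ^+ 2)], whose sum [local_sum] controls. *)
Lemma power_sum_local k (c : R) : 0 < c -> exists2 C : R, 0 <= C &
  cone N (fun i X => C * penalty (N i) (y i) (b i) X + c -
    (pws (N i) X k.+3 - pws (N i) (y i) k.+3) ^+ 2).
Proof.
move=> c0; have [D D0 hD] := pow_coordinate ltJ y1 k.
have D1 : 0 < 2 * D + 2 by rewrite ltr_wpDl // mulr_ge0.
have [|C C0 hS] := @local_sum (c / (2 * D + 2)); first by rewrite divr_gt0.
exists ((2 * D + 2) * C); first by rewrite mulr_ge0 // ltW.
pose B1 i v (X : nat -> R) := X v ^+ k.+2 - y i v ^+ k.+2.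
pose B2 i v (X : nat -> R) := y i v ^+ k.+1 * (X v - y i v).
have polB1 : pol NJ (fun j => B1 (sval j).1 (sval j).2).
  by apply: polB; [exact: polX|exact: pol_cst].
have polB2 : pol NJ (fun j => B2 (sval j).1 (sval j).2).
  by apply: polM; [exact: pol_cst|apply: polB => //; exact: pol_cst].
have h1 := coneZ (c := fun=> 2) (fun=> ler0n _ 2)
  (@cone_cauchy (fun i v X => X v) B1 polx polB1 (fun i X hX => hX)).
have h2 := coneZ (c := fun=> 2) (fun=> ler0n _ 2)
  (@cone_cauchy (fun i v X => y i v) B2 (pol_cst _ _) polB2 (fun i X _ => y_sphere i)).
have h3 := coneZ (c := fun=> 2) (fun=> ler0n _ 2) (cone_sum (G := fun i v X =>
  D * ((X v - y i v) ^+ 2 * (X v ^+ 2 + y i v ^+ 2)) - B1 i v X ^+ 2) hD).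
have h4 : cone N (fun i X => 2 * \sum_(v < N i) ((X v - y i v) ^+ 2 *
    (X v ^+ 2 + y i v ^+ 2) - B2 i v X ^+ 2)).
  apply: (coneZ (c := fun=> 2)) => //.
  apply: (cone_sum (G := fun i v X => (X v - y i v) ^+ 2 *
    (X v ^+ 2 + y i v ^+ 2) - B2 i v X ^+ 2)).
  have h : cone NJ (fun j X => (xJ j X - yJ j) ^+ 2 *
      (xJ j X ^+ 2 + yJ j ^+ 2 * (1 - (yJ j ^+ 2) ^+ k))).
    apply: coneM; first by apply: cone_sq; apply: polB => //; exact: pol_cst.
    apply: coneD; first exact: cone_sq.
    apply: cone_cst => j; rewrite mulr_ge0 ?sqr_ge0 // subr_ge0.
    by rewrite exprn_ile1 ?sqr_ge0 //; exact: y1.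
  apply: cone_ext h => j X _; rewrite /B2 -exprM mulnC exprM (exprS _ k); ring.
have h5 : cone N (fun i X => (\sum_(v < N i) X v * B1 i v X
    - \sum_(v < N i) y i v * B2 i v X) ^+ 2).
  apply: cone_sq; apply: polB.
    by apply: (pol_sum (G := fun i v X => X v * B1 i v X)); apply: polM.
  apply: (pol_sum (G := fun i v X => y i v * B2 i v X)); apply: polM => //.
  exact: pol_cst.
have h6 := coneZ (c := fun=> 2 * D + 2) (fun=> ltW D1) hS.
apply: cone_ext (coneD h1 (coneD h2 (coneD h3 (coneD h4 (coneD h5 h6))))).
move=> i X hX; rewrite !sumrB -!mulr_sumr.
have -> : pws (N i) X k.+3 - pws (N i) (y i) k.+3 =
    \sum_(v < N i) X v * B1 i v X + \sum_(v < N i) y i v * B2 i v X.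
  rewrite /pws -sumrB -big_split; apply: eq_bigr => v _ /=.
  by rewrite /B1 /B2 (exprS _ k.+2) (exprS (y i v) k.+2) (exprS (y i v) k.+1); ring.
by field; rewrite gt_eqF.
Qed.

Lemma cone_power_sum_le1 k : cone N (fun i (X : nat -> R) => 1 - pws (N i) X k.+2 ^+ 2).
Proof.
have h1 := @cone_cauchy (fun i v X => X v) (fun i v (X : nat -> R) => X v ^+ k.+1) polx
  (polX _ polx) (fun i X hX => hX).
have h2 : cone N (fun i (X : nat -> R) => \sum_(v < N i) (X v ^+ 2 * (1 - X v ^+ (2 * k)))).
  apply: (cone_sum (G := fun i v (X : nat -> R) => X v ^+ 2 * (1 - X v ^+ (2 * k)))).
  by apply: coneM; [exact: cone_sq|exact: cone_coord_pow_le1 ltJ k].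
apply: cone_ext (coneD h1 h2) => i X hX.
rewrite (eq_bigr (fun v : 'I_(N i) => X v ^+ 2 - (X v ^+ k.+1) ^+ 2)
  (F1 := fun v : 'I_(N i) => X v ^+ 2 * _)); last first.
  by move=> v _; rewrite mulrBr mulr1 -exprD -exprM mulnC mulSn addnC mulnC addnC.
rewrite sumrB hX /pws (eq_bigr (fun v : 'I_(N i) => X v * X v ^+ k.+1)
  (F1 := fun v : 'I_(N i) => X v ^+ _)); last by move=> v _; rewrite exprS.
ring.
Qed.

Lemma pol_power_sum k : pol N (fun i (X : nat -> R) => pws (N i) X k).
Proof. by apply: (pol_sum (G := fun i v (X : nat -> R) => X v ^+ k)); apply: polX. Qed.

(** The class of functions to which the certificates for power sums extend.
    Boundedness is included because it makes the class stable under products. *)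
Definition tame (u : I -> (nat -> R) -> R) :=
  [/\ pol N u, exists B : R, cone N (fun i X => B ^+ 2 - u i X ^+ 2) &
    forall c : R, 0 < c -> exists2 C : R, 0 <= C &
      cone N (fun i X => C * penalty (N i) (y i) (b i) X + c
        - (u i X - u i (y i)) ^+ 2)].

Lemma tame_ext u w : (forall i X, u i X = w i X) -> tame w -> tame u.
Proof.
move=> uw [h1 [B h2] h3]; split.
- by apply: pol_ext h1.
- by exists B; apply: cone_ext h2 => i X _; rewrite uw.
- move=> c /h3[C C0 h]; exists C => //; apply: cone_ext h => i X _.
  by rewrite !uw.
Qed.

Lemma tame_cst (a : R) : tame (fun _ (_ : nat -> R) => a).
Proof.
split; first exact: pol_cst.
  by exists a; apply: cone_ext (cone_cst (c := fun=> 0) _ _) => // i X _; rewrite subrr.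
move=> c c0; exists 0 => //.
apply: cone_ext (cone_cst (c := fun=> c) N (fun=> ltW c0)) => i X _.
by rewrite subrr expr0n /= mul0r add0r subr0.
Qed.

Lemma tame_power_sum k : tame (fun i (X : nat -> R) => pws (N i) X k.+2).
Proof.
split; first exact: pol_power_sum.
  exists 1; apply: cone_ext (cone_power_sum_le1 k) => i X _.
  by rewrite expr1n.
case: k => [|k] c c0; last exact: power_sum_local.
exists 0 => //.
apply: cone_ext (cone_cst (c := fun=> c) N (fun=> ltW c0)) => i X hX.
have -> : pws (N i) X 2 = pws (N i) (y i) 2 by rewrite /pws hX y_sphere.
by rewrite subrr expr0n /= mul0r add0r subr0.
Qed.

Lemma tameD u w : tame u -> tame w -> tame (fun i X => u i X + w i X).
Proof.
move=> [u1 [B u2] u3] [w1 [D w2] w3]; split; first exact: polD.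
- pose M := B ^+ 2 + D ^+ 2 + 1.
  have h0 : cone N (fun _ (_ : nat -> R) => M ^+ 2 - 2 * B ^+ 2 - 2 * D ^+ 2).
    apply: cone_cst => i.
    have -> : M ^+ 2 - 2 * B ^+ 2 - 2 * D ^+ 2 = (B ^+ 2 + D ^+ 2) ^+ 2 + 1.
      by rewrite /M; ring.
    by apply: addr_ge0 => //; exact: sqr_ge0.
  have h1 := coneZ (c := fun=> 2) (fun=> ler0n _ 2) u2.
  have h2 := coneZ (c := fun=> 2) (fun=> ler0n _ 2) w2.
  have h3 := cone_sq (polB u1 w1).
  exists M; apply: cone_ext (coneD h0 (coneD h1 (coneD h2 h3))) => i X _; ring.
- move=> c c0; have c4 : 0 < c / 4%:R by rewrite divr_gt0.
  have [C C0 hC] := u3 _ c4; have [E E0 hE] := w3 _ c4.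
  exists (2 * C + 2 * E); first by rewrite addr_ge0 // mulr_ge0.
  have h1 := coneZ (c := fun=> 2) (fun=> ler0n _ 2) hC.
  have h2 := coneZ (c := fun=> 2) (fun=> ler0n _ 2) hE.
  have h3 := cone_sq (polB (polB u1 (pol_cst N (fun i => u i (y i))))
    (polB w1 (pol_cst N (fun i => w i (y i))))).
  by apply: cone_ext (coneD h1 (coneD h2 h3)) => i X _; field.
Qed.

Lemma tameM u w : tame u -> tame w -> tame (fun i X => u i X * w i X).
Proof.
move=> [u1 [B u2] u3] [w1 [D w2] w3]; split; first exact: polM.
- have h1 := coneZ (c := fun=> D ^+ 2) (fun=> sqr_ge0 _) u2.
  have h2 := coneM (cone_sq u1) w2.
  by exists (B * D); apply: cone_ext (coneD h1 h2) => i X _; ring.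
- move=> c c0.
  pose M := 2 * (B ^+ 2 + D ^+ 2) + 1.
  have M0 : 0 < M by rewrite ltr_wpDl // mulr_ge0 // addr_ge0 ?sqr_ge0.
  have cM : 0 < c / M by rewrite divr_gt0.
  have [C C0 hC] := u3 _ cM; have [E E0 hE] := w3 _ cM.
  exists (2 * D ^+ 2 * C + 2 * B ^+ 2 * E).
    by apply: addr_ge0; do 2?apply: mulr_ge0 => //; exact: sqr_ge0.
  have dw := polB w1 (pol_cst N (fun i => w i (y i))).
  have du := polB u1 (pol_cst N (fun i => u i (y i))).
  have cwy := pol_cst N (fun i => w i (y i)).
  have h1 := coneZ (c := fun=> 2 * D ^+ 2) (fun=> mulr_ge0 (ler0n _ 2) (sqr_ge0 D)) hC.
  have h2 := coneZ (c := fun=> 2 * B ^+ 2) (fun=> mulr_ge0 (ler0n _ 2) (sqr_ge0 B)) hE.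
  have h3 := coneZ (c := fun=> 2) (fun=> ler0n _ 2) (coneM u2 (cone_sq dw)).
  have wy i : 0 <= 2 * (D ^+ 2 - w i (y i) ^+ 2).
    by rewrite mulr_ge0 //; exact: (cone_ge0 w2 (y_sphere i)).
  have h4 := coneZ wy (cone_sq du).
  have h5 := cone_sq (polB (polM u1 dw) (polM cwy du)).
  have h6 := cone_cst (c := fun=> c / M) N (fun=> ltW cM).
  apply: cone_ext (coneD h1 (coneD h2 (coneD h3 (coneD h4 (coneD h5 h6))))).
  move=> i X _; rewrite [in X in _ + X - _](_ : c = M * (c / M)); last first.
    by rewrite mulrC divfK // gt_eqF.
  by rewrite /M; ring.
Qed.

End Local.

(** * Averaging over random draws *)

Section Sampling.
Variable R : realType.
Local Notation seqs := (nat * ((nat -> R) * (nat -> R)))%type.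

(** The data at which local certificates are available: a dimension, a point [y]
    of the sphere, and approximate cubes which give the signs of its
    coordinates. *)
Definition anchor := {p : seqs | on_sphere p.1 p.2.1 /\
  forall v, (v < p.1)%N -> 0 <= p.2.2 v * p.2.1 v}.
Definition anchor_dim (i : anchor) := (sval i).1.
Definition anchor_pt (i : anchor) := (sval i).2.1.
Definition anchor_cube (i : anchor) := (sval i).2.2.

(** The outcomes of [k] draws: how often each index occurred, and the sum of the
    signs which came with it. *)
Definition tally k := {p : seqs | (forall v, 0 <= p.2.1 v) /\
  \sum_(v < p.1) p.2.1 v = k%:R}.
Definition tally_dim k (i : tally k) := (sval i).1.

(** After [K] draws, [drift] is [K%:R ^+ 2] times the penalty of the empirical
    means. *)
Definition drift n k (c s X : nat -> R) :=
  \sum_(v < n) ((k%:R * X v ^+ 2 - c v) ^+ 2 + (k%:R * X v ^+ 3 - s v) ^+ 2).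

(** The variance of one draw. *)
Definition spread n (X : nat -> R) := 2 - pws n X 4 - pws n X 6.

Definition add_at (a : R) v (c : nat -> R) u := c u + a * (u == v)%:R.

Lemma sum_delta n v (F : nat -> R) : (v < n)%N ->
  \sum_(u < n) (u == v :> nat)%:R * F u = F v.
Proof.
move=> vn; rewrite (bigD1 (Ordinal vn)) //= eqxx mul1r big1 ?addr0 // => u.
by rewrite -val_eqE /= => /negbTE ->; rewrite mul0r.
Qed.

Lemma drift_add_at n k c s X v (e : R) : (v < n)%N -> e ^+ 2 = 1 ->
  drift n k.+1 (add_at 1 v c) (add_at e v s) X =
  \sum_(u < n) (((k%:R * X u ^+ 2 - c u) + X u ^+ 2) ^+ 2
     + ((k%:R * X u ^+ 3 - s u) + X u ^+ 3) ^+ 2)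
  + (2 - 2 * ((k%:R * X v ^+ 2 - c v) + X v ^+ 2)
       - 2 * e * ((k%:R * X v ^+ 3 - s v) + X v ^+ 3)).
Proof.
move=> vn e1.
rewrite -(sum_delta (fun v => 2 - 2 * ((k%:R * X v ^+ 2 - c v) + X v ^+ 2)
       - 2 * e * ((k%:R * X v ^+ 3 - s v) + X v ^+ 3)) vn) -big_split /drift.
apply: eq_bigr => u _; rewrite /add_at -[k.+1]addn1 natrD /=.
by case: eqP => _ /=; [ring: e1|ring].
Qed.

(** One more draw adds the variance to the expected squared deviation: the cross
    terms vanish because [X v ^+ 2] and [X v ^+ 3] are the means of the indicator
    of [v] and of its signed version. *)
Lemma drift_mean n k c s X : on_sphere n X ->
  \sum_(v < n) (X v ^+ 2 * ((1 + X v) / 2) * drift n k.+1 (add_at 1 v c) (add_at 1 v s) X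
    + X v ^+ 2 * ((1 - X v) / 2) * drift n k.+1 (add_at 1 v c) (add_at (-1) v s) X)
  = drift n k c s X + spread n X.
Proof.
move=> hX; set T := \sum_(u < n) (((k%:R * X u ^+ 2 - c u) + X u ^+ 2) ^+ 2
     + ((k%:R * X u ^+ 3 - s u) + X u ^+ 3) ^+ 2).
under eq_bigr => v _.
  rewrite !drift_add_at ?ltn_ord ?expr1n ?sqrrN ?expr1n // -/T.
  rewrite (_ : _ + _ = (T + 2) * X v ^+ 2
    - 2 * (X v ^+ 2 * ((k%:R * X v ^+ 2 - c v) + X v ^+ 2)
         + X v ^+ 3 * ((k%:R * X v ^+ 3 - s v) + X v ^+ 3))); last by field.
  over.
rewrite sumrB -!mulr_sumr hX mulr1.
set S := \sum_(v < n) (X v ^+ 2 * _ + _).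
have -> : drift n k c s X = T - 2 * S + pws n X 4 + pws n X 6.
  rewrite /drift /T /S /pws mulr_sumr -sumrB -!big_split.
  by apply: eq_bigr => v _ /=; ring.
by rewrite /spread; ring.
Qed.

Lemma add_at_tally k (i : tally k) v : (v < tally_dim i)%N ->
  (forall u, 0 <= add_at 1 v (sval i).2.1 u) /\
  \sum_(u < tally_dim i) add_at 1 v (sval i).2.1 u = k.+1%:R.
Proof.
move=> vn; have [c0 cS] := svalP i; split.
  by move=> u; rewrite /add_at addr_ge0 // mul1r ler0n.
rewrite /add_at big_split /= cS -[k.+1]addn1 natrD; congr (_ + _).
rewrite -[RHS](sum_delta (fun=> 1) vn); apply: eq_bigr => u _.
by rewrite mul1r mulr1.
Qed.

Definition add_at_idx k (a : R) (j : coords (@tally_dim k)) : tally k.+1 :=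
  exist _ (tally_dim (sval j).1, (add_at 1 (sval j).2 (sval (sval j).1).2.1,
                                  add_at a (sval j).2 (sval (sval j).1).2.2))
    (add_at_tally (svalP j)).

Variables (g W : nat -> (nat -> R) -> R).
Hypothesis g_local : cone anchor_dim
  (fun i X => g (anchor_dim i) X +
    W (anchor_dim i) X * penalty (anchor_dim i) (anchor_pt i) (anchor_cube i) X).

(** The conditional expectation, given the outcome of the first [k] draws, of the
    local certificate at the empirical means of all the [K] draws. *)
Definition expected K k n (c s X : nat -> R) :=
  g n X + W n X * (K%:R ^- 2 * (drift n k c s X + (K - k)%:R * spread n X)).

Definition expected_cone K k := cone (@tally_dim k)
  (fun i => expected K k (tally_dim i) (sval i).2.1 (sval i).2.2).

Lemma tally_anchor_subproof K (i : tally K) : (0 < K)%N ->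
  let y := fun v => (if 0 <= (sval i).2.2 v then 1 else -1) *
                    Num.sqrt ((sval i).2.1 v / K%:R) in
  let b := fun v => (sval i).2.2 v / K%:R in
  on_sphere (tally_dim i) y /\ forall v, (v < tally_dim i)%N -> 0 <= b v * y v.
Proof.
move=> K0 y b; have [c0 cS] := svalP i.
have KR : 0 < K%:R :> R by rewrite ltr0n.
split.
  rewrite /on_sphere (eq_bigr (fun v : 'I_(tally_dim i) => (sval i).2.1 v / K%:R)).
    by rewrite -mulr_suml cS divff // gt_eqF.
  move=> v _; rewrite /y exprMn sqr_sqrtr; last by rewrite divr_ge0 // ltW.
  by case: ifP; rewrite ?sqrrN expr1n mul1r.
move=> v _; rewrite /b /y mulrA mulr_ge0 ?sqrtr_ge0 //.
rewrite mulrAC divr_ge0 ?(ltW KR) //; case: ifP => [h|/negbT].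
  by rewrite mulr1.
by rewrite -ltNge mulrN1 oppr_ge0 => /ltW.
Qed.

Lemma expected_last K : (0 < K)%N -> expected_cone K K.
Proof.
move=> K0; have KR : 0 < K%:R :> R by rewrite ltr0n.
pose p (i : tally K) : anchor := exist _ (tally_dim i, (_, _)) (tally_anchor_subproof i K0).
apply: cone_ext (cone_reindex p g_local) => i X _.
rewrite /expected subnn mul0r addr0; congr (_ + _ * _).
rewrite /drift /penalty mulr_sumr; apply: eq_bigr => v _.
rewrite /p /anchor_pt /anchor_cube /= exprMn sqr_sqrtr; last first.
  by have [c0 _] := svalP i; rewrite divr_ge0 // ltW.
have -> : (if 0 <= (sval i).2.2 v then 1 else -1) ^+ 2 = 1 :> R.
  by case: ifP; rewrite ?sqrrN expr1n.
by field; rewrite gt_eqF.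
Qed.

Lemma expected_step K k : (k < K)%N ->
  expected_cone K k.+1 -> expected_cone K k.
Proof.
move=> kK h.
have pol_x : pol (fun j : coords (@tally_dim k) => tally_dim (sval j).1)
    (fun j (X : nat -> R) => X (sval j).2).
  by apply: pol_coord => j; exact: svalP j.
have x1 := @cone_coord_le1 R _ _ (fun j : coords (@tally_dim k) => (sval j).2)
  (fun j => svalP j).
have wt (e : R) : e ^+ 2 = 1 ->
    cone (fun j : coords (@tally_dim k) => tally_dim (sval j).1)
    (fun j X => X (sval j).2 ^+ 2 * ((1 + e * X (sval j).2) / 2)).
  move=> e1.
  (* [(1 + e * x) / 2 = ((1 + e * x) ^+ 2 + (1 - x ^+ 2)) / 4] *)
  have h1 := cone_sq (polD (pol_cst _ (fun=> 1)) (polM (pol_cst _ (fun=> e)) pol_x)).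
  have q0 : 0 <= 4%:R^-1 :> R by rewrite invr_ge0 ler0n.
  have h2 := coneM (cone_sq pol_x)
    (coneZ (c := fun=> 4%:R^-1) (fun=> q0) (coneD h1 x1)).
  by apply: cone_ext h2 => j X _; field: e1.
have hp := coneM (wt 1 (expr1n _ _)) (cone_reindex (@add_at_idx k 1) h).
have hm := coneM (wt (-1) (etrans (sqrrN _) (expr1n _ _)))
  (cone_reindex (@add_at_idx k (-1)) h).
have hs := cone_sum (G := fun (i : tally k) v X =>
    X v ^+ 2 * ((1 + 1 * X v) / 2) * expected K k.+1 (tally_dim i)
       (add_at 1 v (sval i).2.1) (add_at 1 v (sval i).2.2) X
  + X v ^+ 2 * ((1 + -1 * X v) / 2) * expected K k.+1 (tally_dim i)
       (add_at 1 v (sval i).2.1) (add_at (-1) v (sval i).2.2) X) (coneD hp hm).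
apply: cone_ext hs => i X hX; rewrite /expected.
have := drift_mean k (sval i).2.1 (sval i).2.2 hX.
set n := tally_dim i; set c := _.2.1; set s := _.2.2 => E.
have -> : (K - k)%:R = (K - k.+1)%:R + 1 :> R by rewrite natr1 subnSK.
set V := spread n X in E *; set w := K%:R ^- 2; set m := (K - k.+1)%:R.
transitivity (g n X + W n X * (w * (m * V)) + W n X * w * (drift n k c s X + V)).
  by ring.
rewrite -E.
transitivity ((g n X + W n X * (w * (m * V))) * \sum_(v < n) X v ^+ 2
  + W n X * w * \sum_(v < n)
   (X v ^+ 2 * ((1 + X v) / 2) * drift n k.+1 (add_at 1 v c) (add_at 1 v s) X
    + X v ^+ 2 * ((1 - X v) / 2) * drift n k.+1 (add_at 1 v c) (add_at (-1) v s) X)).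
  rewrite hX; ring.
by rewrite !mulr_sumr -big_split; apply: eq_bigr => v _ /=; field.
Qed.

(** The penalty can be replaced by its expectation, which for [K] independent
    draws is the variance of one draw divided by [K]. *)
Lemma sampling K : (0 < K)%N ->
  cone (fun n => n) (fun n X => g n X + W n X * (K%:R^-1 * spread n X)).
Proof.
move=> K0.
have : expected_cone K 0.
  have E : forall k, (k <= K)%N -> expected_cone K (K - k).
    elim=> [|k IH] kK; first by rewrite subn0; exact: expected_last.
    apply: expected_step; first by rewrite ltn_subrL K0.
    by rewrite subnSK //; apply: IH; exact: ltnW.
  by have := E K (leqnn K); rewrite subnn.
have P n : (forall v, 0 <= (fun _ : nat => 0 : R) v) /\
    \sum_(v < n) (fun _ : nat => 0 : R) v = 0%:R.
  by split=> //; rewrite big1.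
pose p n : tally 0 := exist _ (n, (fun=> 0, fun=> 0)) (P n).
move=> /(cone_reindex p); apply: cone_ext => n X _.
rewrite /expected /= subn0 (_ : drift _ _ _ _ _ = 0); last first.
  by rewrite /drift big1 // => v _; rewrite !mul0r !subr0 !expr0n addr0.
congr (_ + _ * _); rewrite add0r mulrA; congr (_ * _).
by field; rewrite pnatr_eq0 -lt0n.
Qed.

End Sampling.

(** * Positive univariate polynomials *)

Section Univariate.
Variable R : realType.
Implicit Types p A B : {poly R}.

Lemma poly_pos_quadratic_factor p : (forall x, 0 < p.[x]) -> (1 < size p)%N ->
  exists (a b : R) k, p = k * (('X - a%:P) ^+ 2 + (b ^+ 2)%:P) /\ b != 0.
Proof.
move=> p0 sp.
have /closed_rootP[[a b]] : size (map_poly (real_complex R) p) != 1%N.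
  by rewrite size_map_poly neq_ltn sp orbT.
rewrite /root => /eqP pz.
have b0 : b != 0.
  apply/eqP => b0; move: pz; rewrite b0 => pz.
  have : p.[a]%:C%C = 0 :> R[i] by rewrite -horner_map.
  by case=> pa; have := p0 a; rewrite pa ltxx.
pose q : {poly R} := ('X - a%:P) ^+ 2 + (b ^+ 2)%:P.
have sq : size q = 3%N.
  rewrite /q size_polyDl size_exp_XsubC //.
  by rewrite (leq_ltn_trans (size_polyC_leq1 _)).
have q0 : q != 0 by rewrite -size_poly_eq0 sq.
exists a, b, (p %/ q); split=> //; rewrite -/q.
rewrite {1}(divp_eq p q) -[RHS]addr0; congr (_ + _).
set m := p %% q.
have sm : (size m <= 2)%N by rewrite -ltnS -sq ltn_modp.
have mz : (map_poly (real_complex R) m).[(a +i* b)%C] = 0.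
  move: pz; rewrite {1}(divp_eq p q) rmorphD rmorphM /= hornerD hornerM.
  suff -> : (map_poly (real_complex R) q).[(a +i* b)%C] = 0 by rewrite mulr0 add0r.
  rewrite /q rmorphD rmorphXn rmorphB /= map_polyX !map_polyC /= !hornerE.
  rewrite expr2; apply/eqP; rewrite eq_complex /=; apply/andP; split; apply/eqP => /=.
    by ring.
  by ring.
have : m`_0 + m`_1 * a = 0 /\ m`_1 * b = 0.
  move: mz; rewrite (horner_coef_wide _ (n := 2)); last by rewrite size_map_poly.
  rewrite !big_ord_recl big_ord0 !coef_map /= /bump /= addn0 expr0 expr1 mulr1 addr0.
  move/eqP; rewrite eq_complex /= => /andP[/eqP h1 /eqP h2].
  by split; [apply: etrans h1|apply: etrans h2]; ring.
case=> h0 /eqP; rewrite mulf_eq0 (negbTE b0) orbF => /eqP m1.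
move: h0; rewrite m1 mul0r addr0 => m0.
apply/polyP => -[|[|j]]; rewrite coef0 //.
by rewrite nth_default // (leq_trans sm).
Qed.

(** By induction on the degree: pairs of conjugate roots contribute factors
    [('X - a) ^+ 2 + b ^+ 2], and sums of two squares are stable under products. *)
Lemma poly_pos_two_squares p : (forall x, 0 < p.[x]) ->
  exists A B, [/\ p = A ^+ 2 + B ^+ 2, (size A <= (size p).+1./2)%N &
    (size B <= (size p).+1./2)%N].
Proof.
have [n] := ubnP (size p); elim: n p => // n IH p /ltnSE sp p0.
have [sp1|sp1] := leqP (size p) 1.
  have pc := size1_polyC sp1.
  have p00 : 0 < p`_0 by rewrite -horner_coef0.
  exists (Num.sqrt p`_0)%:P, 0; rewrite size_poly0; split=> //.
    by rewrite expr0n /= addr0 -polyC_exp sqr_sqrtr // ltW.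
  by rewrite [in leqRHS]pc !size_polyC sqrtr_eq0 -ltNge p00 (gt_eqF p00).
have [a [b [k [pE b0]]]] := poly_pos_quadratic_factor p0 sp1.
pose q : {poly R} := ('X - a%:P) ^+ 2 + (b ^+ 2)%:P.
have sq : size q = 3%N.
  rewrite /q size_polyDl size_exp_XsubC //.
  by rewrite (leq_ltn_trans (size_polyC_leq1 _)).
have k0 x : 0 < k.[x].
  have := p0 x; rewrite pE hornerM pmulr_lgt0 // !hornerE.
  by rewrite ltr_wpDl ?sqr_ge0 // exprn_even_gt0.
have kn0 : k != 0 by apply/eqP => k00; have := k0 0; rewrite k00 horner0 ltxx.
have q0 : q != 0 by rewrite -size_poly_eq0 sq.
have spk : size p = (size k).+2 by rewrite pE -/q size_mul // sq addn3.
have [|A [B [kE sA sB]]] := IH k _ k0; first by rewrite -ltnS -spk ltnW // ltnS.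
have sX (C : {poly R}) : (size C <= (size k).+1./2)%N ->
    (size (('X - a%:P) * C)%R <= (size p).+1./2)%N.
  move=> sC; rewrite (leq_trans (size_polyMleq _ _)) // size_XsubC /=.
  by rewrite spk /= ltnS.
have sb (C : {poly R}) : (size C <= (size k).+1./2)%N ->
    (size (b%:P * C)%R <= (size p).+1./2)%N.
  move=> sC; rewrite mul_polyC (leq_trans (size_scale_leq _ _)) //.
  by rewrite spk /= (leq_trans sC).
exists (('X - a%:P) * A - b%:P * B), (('X - a%:P) * B + b%:P * A); split.
- by rewrite pE kE rmorphXn /=; ring.
- by rewrite (leq_trans (size_polyD _ _)) // size_polyN geq_max sX ?sb.
- by rewrite (leq_trans (size_polyD _ _)) // geq_max sX ?sb.
Qed.

(** For [`|t|] above a threshold [T] the leading term wins, and below it the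
    even powers are bounded; [T] depends only on [r], [e] and [B]. *)
Lemma even_powers_margin r (e B : R) : 0 < e -> exists2 eta : R, 0 < eta &
  forall a : nat -> R, (forall j, (j <= 2 * r)%N -> `|a j| <= B) ->
    e <= a (2 * r)%N ->
    (forall t, e <= \sum_(j < (2 * r).+1) a j * t ^+ j) ->
  forall t, eta * \sum_(l < r.+1) t ^+ (2 * l) < \sum_(j < (2 * r).+1) a j * t ^+ j.
Proof.
move=> e0; pose T := 1 + `|B| * (4 * r)%:R / e.
have T1 : 1 <= T by rewrite lerDl divr_ge0 ?mulr_ge0 // ltW.
have T0 : 0 < T by exact: lt_le_trans T1.
pose D := 4%:R * (r.+1)%:R * T ^+ (2 * r).
have D0 : 0 < D by rewrite !mulr_gt0 ?ltr0n // exprn_gt0.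
have Dsimpl : e / D * r.+1%:R = e / 4%:R / T ^+ (2 * r).
  have gen (n P : R) : n != 0 -> P != 0 -> e / (4%:R * n * P) * n = e / 4%:R / P.
    by move=> n0 P0; field; rewrite ?n0 ?P0.
  by apply: gen; rewrite ?pnatr_eq0 // expf_neq0 // gt_eqF.
exists (e / D) => [|a aB ae fe t]; first exact: divr_gt0.
have Wle M : 1 <= M -> `|t| <= M ->
    \sum_(l < r.+1) t ^+ (2 * l) <= r.+1%:R * M ^+ (2 * r).
  move=> M1 tM; rewrite -[r.+1 in leRHS]card_ord mulr_natl -sumr_const.
  apply: ler_sum => l _; rewrite exprM -(real_normK (num_real t)) -exprM.
  apply: le_trans (_ : M ^+ (2 * l) <= _); first by rewrite lerXn2r ?nnegrE // (le_trans _ M1).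
  by rewrite ler_weXn2l // leq_mul2l -ltnS ltn_ord orbT.
have [tT|Tt] := lerP `|t| T.
  apply: lt_le_trans (fe t).
  apply: le_lt_trans (_ : e / 4%:R < e); last first.
    by rewrite ltr_pdivrMr // ltr_pMr // ltr1n.
  apply: le_trans (ler_wpM2l _ (Wle T T1 tT)) _; first by rewrite ltW // divr_gt0.
  by rewrite mulrA Dsimpl divfK // expf_neq0 // gt_eqF.
have t1 : 1 <= `|t| by exact: le_trans T1 (ltW Tt).
have t0 : 0 < `|t| by exact: lt_le_trans t1.
have tE : `|t| ^+ (2 * r) = t ^+ (2 * r) by rewrite -normrX ger0_norm // exprM exprn_ge0 // sqr_ge0.
have P0 : 0 < t ^+ (2 * r) by rewrite -tE exprn_gt0.
apply: lt_le_trans (_ : e / 2 * t ^+ (2 * r) <= _).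
  apply: le_lt_trans (ler_wpM2l _ (Wle `|t| t1 (lexx _))) _; first by rewrite ltW // divr_gt0.
  rewrite tE mulrA ltr_pM2r // Dsimpl.
  apply: le_lt_trans (_ : e / 4%:R < _).
    rewrite ler_pdivrMr ?exprn_gt0 // ler_peMr ?exprn_ege1 //.
    by rewrite divr_ge0 // ltW.
  by rewrite ltr_pM2l // ltf_pV2 ?posrE // ltr_nat.
rewrite big_ord_recr /=.
have low : `|\sum_(j < 2 * r) a j * t ^+ j| <= e / 2 * t ^+ (2 * r).
  apply: le_trans (ler_norm_sum _ _ _) _.
  apply: le_trans (_ : \sum_(j < 2 * r) `|B| / T * t ^+ (2 * r) <= _).
    apply: ler_sum => j _; rewrite normrM normrX -tE -mulrA ler_pM ?exprn_ge0 ?normr_ge0 //.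
      by apply: le_trans (aB _ (ltnW (ltn_ord j))) (ler_norm _).
    rewrite mulrC ler_pdivlMr //.
    apply: le_trans (_ : `|t| ^+ j.+1 <= _); last by rewrite ler_weXn2l.
    by rewrite exprSr ler_wpM2l ?exprn_ge0 // ltW.
  rewrite sumr_const card_ord -[_ *+ (2 * r)]mulr_natl mulrA ler_pM2r //.
  rewrite mulrA ler_pdivrMr // /T.
  have -> : e / 2 * (1 + `|B| * (4 * r)%:R / e) = e / 2 + (2 * r)%:R * `|B|.
    by rewrite !natrM; field; rewrite gt_eqF.
  by rewrite lerDr ltW // divr_gt0.
move: low; rewrite ler_norml => /andP[low _].
have : e * t ^+ (2 * r) <= a (2 * r)%N * t ^+ (2 * r) by rewrite ler_pM2r.
move: low; set S := \sum_(j < _) _; set P := t ^+ (2 * r); lra.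
Qed.

End Univariate.

(** * Evaluation of symmetric functions *)

Section Substitution.
Variables (R : realType) (S : comNzRingType) (iota : {rmorphism R -> S}).
Variable q : nat -> S.

Definition monom_subst (m : {cmonom nat}) : S := \prod_(i <- finsupp m) q i.+1 ^+ m i.

Lemma monom_substE (m : {cmonom nat}) (d : {fset nat}) : (finsupp m `<=` d)%fset ->
  monom_subst m = \prod_(i <- d) q i.+1 ^+ m i.
Proof.
move=> md; apply: big_fset_incl => // i _ im.
by rewrite (_ : m i = 0%N) ?expr0 //; apply/eqP; rewrite cmE_eq0.
Qed.

Lemma monom_subst_morph : mmorphism monom_subst.
Proof.
split=> [m1 m2|]; last by rewrite /monom_subst mdom1 big_seq_fset0.
rewrite (monom_substE (fsubsetUl (finsupp m1) (finsupp m2))).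
rewrite (monom_substE (fsubsetUr (finsupp m1) (finsupp m2))) /monom_subst mdomD -[RHS]big_split.
by apply: eq_bigr => i _; rewrite cmM exprD.
Qed.

HB.instance Definition _ :=
  monalg.isMultiplicative.Build {cmonom nat} S monom_subst monom_subst_morph.

Lemma psubstE (f : Lambda R) : psubst iota q f = monalg.mmap iota monom_subst f.
Proof. by []. Qed.

Lemma psubstM (f g : Lambda R) :
  psubst iota q (f * g) = psubst iota q f * psubst iota q g.
Proof. by rewrite !psubstE rmorphM. Qed.

Lemma psubstX (f : Lambda R) k : psubst iota q (f ^+ k) = psubst iota q f ^+ k.
Proof. by rewrite !psubstE rmorphXn. Qed.

Lemma psubst_sum (J : Type) (s : seq J) (F : J -> Lambda R) :
  psubst iota q (\sum_(j <- s) F j) = \sum_(j <- s) psubst iota q (F j).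
Proof. by rewrite psubstE raddf_sum. Qed.

Lemma psubst_psum k : psubst iota q (psum R k.+1) = q k.+1.
Proof.
rewrite psubstE /psum mmapU /= (rmorph1 iota) mul1r /monom_subst mdomU big_seq_fset1.
by rewrite cmUU expr1.
Qed.

Lemma psubst_comp (T : comNzRingType) (phi : {rmorphism S -> T}) (f : Lambda R) :
  phi (psubst iota q f) = psubst (fun a => phi (iota a)) (fun k => phi (q k)) f.
Proof.
rewrite /psubst !monalg.mmapE rmorph_sum; apply: eq_bigr => m _.
rewrite rmorphM rmorph_prod; congr (_ * _); apply: eq_bigr => i _.
by rewrite rmorphXn.
Qed.

End Substitution.

Lemma psubst_ext (R : realType) (S : comNzRingType) (iota iota' : R -> S)
    (q q' : nat -> S) (f : Lambda R) :
  iota =1 iota' -> (forall k, q k.+1 = q' k.+1) -> psubst iota q f = psubst iota' q' f.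
Proof.
move=> ii qq; rewrite /psubst !monalg.mmapE; apply: eq_bigr => m _.
by rewrite ii; congr (_ * _); apply: eq_bigr => i _; rewrite qq.
Qed.

Definition ev (R : realType) (q : nat -> R) (f : Lambda R) : R := psubst idfun q f.

Section Evaluation.
Variable R : realType.
Implicit Types (f g : Lambda R) (X y : nat -> R).

Lemma ev_ext (q q' : nat -> R) f : (forall k, q k.+1 = q' k.+1) -> ev q f = ev q' f.
Proof. by move=> qq; apply: psubst_ext. Qed.

Lemma ev_ext_A m (q q' : nat -> R) f : in_A m f ->
  (forall k, q k.+2 = q' k.+2) -> ev q f = ev q' f.
Proof.
move=> fA qq; rewrite /ev /psubst !monalg.mmapE !big_seq; apply: eq_bigr => u uf.
congr (_ * _); rewrite !big_seq; apply: eq_bigr => i iu.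
by have /andP[] := fA u uf i iu; case: i {iu} => // i _ _; rewrite qq.
Qed.

Lemma meval_trunc n f X : (trunc n f).@[restr X] = ev (pws n X) f.
Proof.
rewrite /trunc psubst_comp; apply: psubst_ext => [a|k]; first exact: mevalC.
rewrite raddf_sum; apply: eq_bigr => v _ /=.
by rewrite rmorphXn /= mevalXU.
Qed.

Lemma horner_psubst (q : nat -> {poly R}) f e :
  (psubst polyC q f).[e] = ev (fun k => (q k).[e]) f.
Proof.
rewrite -[LHS]/(horner_eval e (psubst polyC q f)) psubst_comp.
apply: psubst_ext => [a|k] //=.
exact: hornerC.
Qed.

Lemma sym_eval_pws n X : exists x : Rinfty R,
  forall f, sym_eval x f = ev (pws n X) f.
Proof.
pose D : {fset nat} := [fset i in iota 0 n]%fset.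
have memD i : (i \in D) = (i < n)%N by rewrite in_fset /= mem_iota.
exists [fsfun i in D => X i] => f; apply: ev_ext => k.
rewrite (@big_fset_incl _ _ _ _ _ D); first last.
- by move=> i _; rewrite memNfinsupp => /eqP ->; rewrite expr0n.
- by apply/fsubsetP => i; rewrite mem_finsupp fsfun_fun; case: ifP => //; rewrite eqxx.
rewrite /pws -(big_mkord xpredT (fun v => X v ^+ k.+1)) /index_iota subn0.
rewrite (perm_big (iota 0 n)) /=; last first.
  by apply: uniq_perm; rewrite ?fset_uniq ?iota_uniq // => i; rewrite memD mem_iota.
rewrite !big_seq; apply: eq_bigr => i; rewrite mem_iota => /= iltn.
by rewrite fsfun_fun memD iltn.
Qed.

Lemma homog_scale (n e : nat) (p : {mpoly R[n]}) a X : p \is e.-homog ->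
  p.@[restr (fun v => a * X v)] = a ^+ e * p.@[restr X].
Proof.
move=> /dhomogP hp; rewrite !mevalE mulr_sumr; rewrite !big_seq.
apply: eq_bigr => m /hp /= mE; rewrite mulrCA; congr (_ * _).
rewrite (eq_bigr (fun i : 'I_n => a ^+ m i * X i ^+ m i)); last first.
  by move=> i _; rewrite /restr exprMn.
by rewrite big_split /= prodrXr -mdegE -mE.
Qed.

Lemma sym_homog_scale e f n a X : sym_homog e f ->
  ev (pws n (fun v => a * X v)) f = a ^+ e * ev (pws n X) f.
Proof. by move=> hf; rewrite -!meval_trunc (homog_scale a X (hf n)). Qed.

(** By homogeneity the lower bound on the unit sphere spreads to all points. *)
Lemma homog_lower_bound d (e : R) f : sym_homog (2 * d) f ->
  (forall x : Rinfty R, sym_eval x (psum R 2) = 1 -> e <= sym_eval x f) ->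
  forall n X, 0 < pws n X 2 -> e * pws n X 2 ^+ d <= ev (pws n X) f.
Proof.
move=> hf h n X p0; pose a := Num.sqrt (pws n X 2).
have a0 : 0 < a by rewrite sqrtr_gt0.
have a2 : a ^+ 2 = pws n X 2 by rewrite sqr_sqrtr // ltW.
have [x hx] := sym_eval_pws n (fun v => a^-1 * X v).
have := h x; rewrite !hx /ev psubst_psum -/(ev _ _) => h1.
have {h1}: e <= ev (pws n (fun v => a^-1 * X v)) f.
  apply: h1; rewrite /pws; under eq_bigr do rewrite exprMn.
  by rewrite -mulr_sumr -/(pws _ _ _) -a2 -exprMn mulVf ?expr1n // gt_eqF.
rewrite (sym_homog_scale n _ _ hf) -a2 -exprM => h1.
rewrite -ler_pdivlMr ?exprn_gt0 //; apply: le_trans h1 _.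
by rewrite exprVn mulrC.
Qed.

Lemma poly_ge_limit (P : {poly R}) e :
  (forall N, (0 < N)%N -> e <= P.[N%:R^-1]) -> e <= P.[0].
Proof.
move=> h; rewrite leNgt; apply/negP => Pe.
have d0 : 0 < e - P.[0] by rewrite subr_gt0.
have [dl dl0 hd] := poly_cont 0 P d0.
pose N := (Num.bound dl^-1).
have bN : dl^-1 < N%:R by apply: archi_boundP; rewrite invr_ge0 ltW.
have N0 : (0 < N)%N.
  by rewrite -(ltr_nat R) (lt_trans _ bN) // invr_gt0.
have := hd N%:R^-1; rewrite subr0 ger0_norm ?invr_ge0 ?ler0n // => hN.
have {hN}: `|P.[N%:R^-1] - P.[0]| < e - P.[0].
  by apply: hN; rewrite invf_plt ?posrE // ltr0n.
by rewrite ltr_norml => /andP[_]; rewrite ltrD2r ltNge h.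
Qed.

(** Adding [N] coordinates [u / N] moves [p_1] by [u], and changes the other
    power sums by [O(1/N)]. *)
Lemma pws_extend n N y (u : R) k : (0 < N)%N ->
  pws (n + N) (fun v => if (v < n)%N then y v else u / N%:R) k.+1 =
  pws n y k.+1 + u ^+ k.+1 * N%:R^-1 ^+ k.
Proof.
move=> N0; rewrite /pws big_split_ord /=; congr (_ + _).
  by apply: eq_bigr => v _; rewrite ltn_ord.
rewrite (eq_bigr (fun=> (u / N%:R) ^+ k.+1)); last first.
  by move=> v _; rewrite ltnNge leq_addr.
rewrite sumr_const card_ord exprMn -[_ *+ N]mulr_natl mulrCA; congr (_ * _).
by rewrite exprS mulrA divff ?mul1r // pnatr_eq0 -lt0n.
Qed.

(** The values at the points [y, u / N, ..., u / N] are the values at [N^-1] of a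
    polynomial, whose value at [0] is obtained by replacing [p_1] by [t] and
    keeping the other power sums of [y]. *)
Lemma free_p1_lower_bound d (e : R) f r m (c : nat -> Lambda R) : 0 < e ->
  (forall j, (j <= 2 * r)%N -> in_A m (c j)) ->
  sym_homog (2 * d) f ->
  f = \sum_(j < (2 * r).+1) c j * psum R 1 ^+ j ->
  (forall x : Rinfty R, sym_eval x (psum R 2) = 1 -> e <= sym_eval x f) ->
  forall n y t, on_sphere n y ->
    e <= \sum_(j < (2 * r).+1) ev (pws n y) (c j) * t ^+ j.
Proof.
move=> e0 cA hf fE h n y t hy; pose u := t - pws n y 1.
pose q k : {poly R} := (pws n y k)%:P + u ^+ k *: 'X^(k.-1).
have qE k x : (q k.+1).[x] = pws n y k.+1 + u ^+ k.+1 * x ^+ k.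
  by rewrite /q !hornerE.
pose P := psubst polyC q f.
have PE x : P.[x] = \sum_(j < (2 * r).+1) ev (fun k => (q k).[x]) (c j) * t ^+ j.
  rewrite /P horner_psubst fE /ev psubst_sum; apply: eq_bigr => j _.
  by rewrite psubstM psubstX psubst_psum qE expr0 mulr1 expr1 /u addrC subrK.
have -> : \sum_(j < (2 * r).+1) ev (pws n y) (c j) * t ^+ j = P.[0].
  rewrite PE; apply: eq_bigr => j _; congr (_ * _).
  apply: (ev_ext_A (cA j _)) => [|k]; first by rewrite -ltnS ltn_ord.
  by rewrite qE expr0n mulr0 addr0.
apply: poly_ge_limit => N N0.
rewrite /P horner_psubst.
have := homog_lower_bound hf h (n := n + N)
  (X := fun v => if (v < n)%N then y v else u / N%:R).
rewrite pws_extend // [pws n y 2]hy expr1 => hN.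
have p1 : 1 <= 1 + u ^+ 2 / N%:R by rewrite lerDl divr_ge0 ?sqr_ge0.
rewrite (@ev_ext _ (pws (n + N) (fun v => if (v < n)%N then y v else u / N%:R))).
  apply: le_trans (hN (lt_le_trans ltr01 p1)).
  by rewrite ler_peMr ?(ltW e0) // exprn_ege1.
by move=> k; rewrite qE pws_extend.
Qed.

End Evaluation.

(** * Uniform sums of squares for positive symmetric functions *)

Section Assembly.
Variables (R : realType) (I : Type) (N : I -> nat) (y b : I -> nat -> R).
Hypothesis y_sphere : forall i, on_sphere (N i) (y i).
Hypothesis by_ge0 : forall i v, (v < N i)%N -> 0 <= b i v * y i v.

Lemma tame_ev m (phi : Lambda R) : in_A m phi ->
  tame N y b (fun i X => ev (pws (N i) X) phi).
Proof.
move=> phiA.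
have tame_exp u k : tame N y b u -> tame N y b (fun i X => u i X ^+ k).
  move=> hu; elim: k => [|k IH]; first exact: tame_cst.
  by apply: tame_ext (tameM y_sphere hu IH) => i X; rewrite exprS.
have hprod (u : {cmonom nat}) (s : seq nat) : {in s, forall i, (2 <= i.+1)%N} ->
    tame N y b (fun i X => \prod_(j <- s) pws (N i) X j.+1 ^+ u j).
  elim: s => [|j s IH] hs.
    by apply: tame_ext (tame_cst N y b 1) => i X; rewrite big_nil.
  have hj := hs j (mem_head _ _).
  have : tame N y b (fun i X => pws (N i) X j.+1 ^+ u j).
    by case: j hj {hs} => // j _; apply: tame_exp; exact: tame_power_sum.
  move=> /(tameM y_sphere) /(_ (IH _)) hh.
  apply: tame_ext (hh _) => [i X|k ks]; first by rewrite big_cons.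
  by apply: hs; rewrite inE ks orbT.
have hsum (s : seq {cmonom nat}) : {subset s <= monalg.msupp phi} ->
    tame N y b (fun i X => \sum_(u <- s) monalg.mcoeff u phi *
      \prod_(j <- finsupp u) pws (N i) X j.+1 ^+ u j).
  elim: s => [|u s IH] hs.
    by apply: tame_ext (tame_cst N y b 0) => i X; rewrite big_nil.
  have hu : {in finsupp u, forall i, (2 <= i.+1)%N}.
    by move=> i iu; have /andP[] := phiA u (hs u (mem_head _ _)) i iu.
  have hs' : {subset s <= monalg.msupp phi}.
    by move=> w ws; apply: hs; rewrite inE ws orbT.
  apply: tame_ext (tameD (tameM y_sphere (tame_cst N y b _) (hprod u _ hu)) (IH hs')) => i X.
  by rewrite big_cons.
exact: tame_ext (hsum _ (fun u h => h)).
Qed.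

Lemma pol_horner (A : I -> {poly R}) m u : pol N u ->
  (forall i, (size (A i) <= m)%N) -> pol N (fun i X => (A i).[u i X]).
Proof.
move=> hu hA.
have h k : pol N (fun i X => \sum_(l < k) (A i)`_l * u i X ^+ l).
  elim: k => [|k IH].
    by apply: pol_ext (pol_cst N (fun=> 0)) => i X _; rewrite big_ord0.
  apply: pol_ext (polD IH (polM (pol_cst N (fun i => (A i)`_k)) (polX k hu))).
  by move=> i X _; rewrite big_ord_recr.
by apply: pol_ext (h m) => i X _; rewrite (horner_coef_wide _ (hA i)).
Qed.

Variables (r : nat) (phi : nat -> I -> (nat -> R) -> R) (eta : R).
Hypothesis eta0 : 0 < eta.
Hypothesis phi_tame : forall j, (j <= 2 * r)%N -> tame N y b (phi j).
Hypothesis phi_pos : forall i t,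
  eta * \sum_(l < r.+1) t ^+ (2 * l) < \sum_(j < (2 * r).+1) phi j i (y i) * t ^+ j.

Let t (i : I) X : R := pws (N i) X 1.
Definition weight n (X : nat -> R) := \sum_(l < r.+1) pws n X 1 ^+ (2 * l).
Let W i X := weight (N i) X.
Let polt : pol N t. Proof. exact: pol_power_sum. Qed.

Lemma cone_weight_sub l : (l <= r)%N -> cone N (fun i X => W i X - t i X ^+ (2 * l)).
Proof.
move=> lr.
have sq k : cone N (fun i X => t i X ^+ (2 * k)).
  by apply: cone_ext (cone_sq (polX k polt)) => i X _; rewrite mulnC exprM.
have hs (s : seq 'I_r.+1) (P : pred 'I_r.+1) :
    cone N (fun i X => \sum_(k <- s | P k) t i X ^+ (2 * k)).
  elim: s => [|k s IH].
    by apply: cone_ext (cone_cst (c := fun=> 0) N _) => // i X _; rewrite big_nil.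
  case Pk: (P k).
    by apply: cone_ext (coneD (sq k) IH) => i X _; rewrite big_cons Pk.
  by apply: cone_ext IH => i X _; rewrite big_cons Pk.
have lr' : (l < r.+1)%N by [].
apply: cone_ext (hs _ (predC1 (Ordinal lr'))) => i X _.
by rewrite /W /weight (bigD1 (Ordinal lr')) //= addrAC subrr add0r.
Qed.

Lemma cone_weight : cone N W.
Proof.
apply: cone_ext (coneD (cone_weight_sub (leq0n r)) (cone_sq (polX 0 polt))) => i X _.
by rewrite muln0 !expr0 expr1n subrK.
Qed.

(** For each [i], freezing the coefficients at [y i] leaves a positive polynomial
    in [t], a sum of two squares of polynomials of degree at most [r]: this
    bound is what makes the level uniform. *)
Lemma cone_anchor_part : cone N (fun i X =>
  \sum_(j < (2 * r).+1) phi j i (y i) * t i X ^+ j - eta * W i X).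
Proof.
pose P i : {poly R} := \poly_(j < (2 * r).+1) phi j i (y i) -
  eta *: \sum_(l < r.+1) 'X^(2 * l).
have PE i x : (P i).[x] = \sum_(j < (2 * r).+1) phi j i (y i) * x ^+ j
    - eta * \sum_(l < r.+1) x ^+ (2 * l).
  rewrite /P hornerD hornerN hornerZ horner_poly horner_sum; congr (_ - _ * _).
  by apply: eq_bigr => l _; rewrite hornerXn.
have sP i : (size (P i) <= (2 * r).+1)%N.
  rewrite (leq_trans (size_polyD _ _)) // geq_max size_poly size_polyN /=.
  rewrite (leq_trans (size_scale_leq _ _)) // (leq_trans (size_sum _ _ _)) //.
  apply/bigmax_leqP => l _; rewrite size_polyXn ltnS leq_mul2l /=.
  by rewrite -ltnS ltn_ord.
have /choice[AB hAB] : forall i, exists AB : {poly R} * {poly R},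
    [/\ P i = AB.1 ^+ 2 + AB.2 ^+ 2, (size AB.1 <= r.+1)%N & (size AB.2 <= r.+1)%N].
  move=> i; have [|A [B [h1 h2 h3]]] := @poly_pos_two_squares R (P i).
    by move=> x; rewrite PE subr_gt0.
  have hr : ((size (P i)).+1./2 <= r.+1)%N.
    have := sP i; move: (size _) => z; lia.
  by exists (A, B); split=> //=; [exact: leq_trans h2 hr|exact: leq_trans h3 hr].
have hA : pol N (fun i X => (AB i).1.[t i X]).
  by apply: (pol_horner (m := r.+1)) => // i; case: (hAB i).
have hB : pol N (fun i X => (AB i).2.[t i X]).
  by apply: (pol_horner (m := r.+1)) => // i; case: (hAB i).
apply: cone_ext (coneD (cone_sq hA) (cone_sq hB)) => i X _.
have [h _ _] := hAB i.
by rewrite /W /weight -PE h hornerD !horner_exp.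
Qed.


(** An error in the coefficient of [t ^+ j] is absorbed by the even powers: for
    [j = l + l'] it is the cross term in the square of [D * t ^+ l + K^-1 * t ^+ l']. *)
Lemma cone_monomial_deviation j (K : R) (D : I -> (nat -> R) -> R) :
  (j <= 2 * r)%N -> 0 < K -> pol N D ->
  cone N (fun i X => D i X * t i X ^+ j
    + (K / 2 * D i X ^+ 2 + (2 * K)^-1) * W i X).
Proof.
move=> jr K0 hD; pose l := j./2; pose l' := (j - j./2)%N.
have lr : (l <= r)%N by rewrite /l; lia.
have lr' : (l' <= r)%N by rewrite /l'; lia.
have h1 : cone N (fun i X => K / 2 * (D i X * t i X ^+ l + K^-1 * t i X ^+ l') ^+ 2).
  apply: (coneZ (c := fun=> K / 2)) => [i|]; first by rewrite divr_ge0 // ltW.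
  apply: cone_sq; apply: polD; apply: polM; [exact: hD|exact: polX|exact: pol_cst|exact: polX].
have h2 := coneZ (c := fun=> K / 2) (fun=> divr_ge0 (ltW K0) (ler0n _ 2))
  (coneM (cone_sq hD) (cone_weight_sub lr)).
have K2 : 0 <= (2 * K)^-1 by rewrite invr_ge0 mulr_ge0 // ltW.
have h3 := coneZ (c := fun=> (2 * K)^-1) (fun=> K2) (cone_weight_sub lr').
apply: cone_ext (coneD h1 (coneD h2 h3)) => i X _.
have -> : t i X ^+ j = t i X ^+ l * t i X ^+ l' by rewrite -exprD subnKC // /l; lia.
by rewrite !(mulnC 2) !exprM; field; rewrite gt_eqF.
Qed.

Lemma cone_deviation_sum K c m : 0 < K -> 0 < c -> (m <= (2 * r).+1)%N ->
  exists2 M : R, 0 <= M & cone N (fun i X =>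
    \sum_(j < m) (phi j i X - phi j i (y i)) * t i X ^+ j
    + (M * penalty (N i) (y i) (b i) X + m%:R * (K / 2 * c + (2 * K)^-1)) * W i X).
Proof.
move=> K0 c0; elim: m => [|m IH] mr.
  exists 0 => //; apply: cone_ext (cone_cst (c := fun=> 0) N _) => // i X _.
  by rewrite big_ord0 !mul0r addr0 mul0r addr0.
have [M M0 hM] := IH (ltnW mr).
have [h1 _ /(_ c c0)[C C0 h2]] := phi_tame mr.
exists (M + K / 2 * C).
  by apply: addr_ge0 => //; apply: mulr_ge0 => //; rewrite divr_ge0 // ltW.
have h3 := cone_monomial_deviation mr K0 (polB h1 (pol_cst N (fun i => phi m i (y i)))).
have h4 := coneZ (c := fun=> K / 2) (fun=> divr_ge0 (ltW K0) (ler0n _ 2))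
  (coneM h2 cone_weight).
apply: cone_ext (coneD hM (coneD h3 h4)) => i X _.
by rewrite big_ord_recr /= -[m.+1]addn1 natrD; ring.
Qed.

Lemma cone_local : exists2 M : R, 0 <= M & cone N (fun i X =>
  \sum_(j < (2 * r).+1) phi j i X * t i X ^+ j - eta / 2 * W i X
  + M * W i X * penalty (N i) (y i) (b i) X).
Proof.
pose n : R := (2 * r).+1%:R; pose K := 2 * n / eta.
have n0 : 0 < n by rewrite ltr0n.
have K0 : 0 < K by rewrite divr_gt0 // mulr_gt0.
have [|M M0 hM] := @cone_deviation_sum K (eta / (2 * n * K)) _ K0 _ (leqnn _).
  by apply: divr_gt0 => //; do 2![apply: mulr_gt0 => //].
exists M => //; apply: cone_ext (coneD hM cone_anchor_part) => i X _.
have -> : n * (K / 2 * (eta / (2 * n * K)) + (2 * K)^-1) = eta / 2.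
  have gen (k : R) : k != 0 -> k * (2 * k / eta / 2 * (eta / (2 * k * (2 * k / eta)))
      + (2 * (2 * k / eta))^-1) = eta / 2.
    by move=> k0; field; rewrite k0 gt_eqF.
  by apply: gen; rewrite gt_eqF.
have -> : \sum_(j < (2 * r).+1) (phi j i X - phi j i (y i)) * t i X ^+ j =
  \sum_(j < (2 * r).+1) phi j i X * t i X ^+ j -
  \sum_(j < (2 * r).+1) phi j i (y i) * t i X ^+ j.
  by rewrite -sumrB; apply: eq_bigr => j _; rewrite mulrBl.
by field.
Qed.

End Assembly.

Section Global.
Variable R : realType.

Lemma cone_spread : exists2 q : nat -> (nat -> R) -> R, cone (fun n => n) q &
  forall n X, spread n X = 2 - q n X.
Proof.
exists (fun n X => pws n X 4 + pws n X 6); last first.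
  by move=> n X; rewrite /spread opprD addrA.
have polx : pol (fun j : coords (fun n : nat => n) => (sval j).1)
    (fun j (X : nat -> R) => X (sval j).2).
  by apply: pol_coord => -[].
have h k : cone (fun n => n) (fun n (X : nat -> R) => pws n X (k * 2)).
  apply: (cone_sum (m := fun n => n) (G := fun n v (X : nat -> R) => X v ^+ (k * 2))).
  by apply: cone_ext (cone_sq (polX k polx)) => j X _; rewrite exprM.
exact: coneD (h 2%N) (h 3%N).
Qed.

Lemma cone_positive (d m : nat) (eps : R) (f : Lambda R) (r : nat)
    (c : nat -> Lambda R) : 0 < eps -> sym_homog (2 * d) f ->
  (forall j, (j <= 2 * r)%N -> in_A m (c j)) ->
  f = \sum_(j < (2 * r).+1) c j * psum R 1 ^+ j ->
  (forall x : Rinfty R, sym_eval x (psum R 2) = 1 -> eps <= sym_eval x f) ->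
  (forall x : Rinfty R, sym_eval x (psum R 2) = 1 -> eps <= sym_eval x (c (2 * r)%N)) ->
  cone (fun n => n) (fun n X => ev (pws n X) f).
Proof.
move=> eps0 hf cA fE h1 h2.
pose N := @anchor_dim R; pose y := @anchor_pt R; pose b := @anchor_cube R.
have y_sphere i : on_sphere (N i) (y i) by have [] := svalP i.
have by_ge0 i v : (v < N i)%N -> 0 <= b i v * y i v by have [_] := svalP i; apply.
pose phi j i X := ev (pws (N i) X) (c j).
have phi_tame j : (j <= 2 * r)%N -> tame N y b (phi j).
  by move=> jr; apply: (tame_ev y_sphere by_ge0 (cA j jr)).
have [B hB] : exists B : R, forall i j, (j <= 2 * r)%N -> `|phi j i (y i)| <= B.
  have : forall k, (k <= (2 * r).+1)%N -> exists B : R, forall i j, (j < k)%N ->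
      `|phi j i (y i)| <= B.
    elim=> [|k IH] kr; first by exists 0.
    have [B hB] := IH (ltnW kr).
    have [_ [D hD] _] := phi_tame k kr.
    exists (Num.max B `|D|) => i j; rewrite ltnS leq_eqVlt => /orP[/eqP->|jk].
      rewrite le_max; apply/orP; right.
      rewrite -(ler_sqr (normr_nneg _) (normr_nneg _)) !real_normK ?num_real //.
      by rewrite -subr_ge0; exact: (cone_ge0 hD (y_sphere i)).
    by rewrite le_max hB.
  by move=> /(_ _ (leqnn _))[B hB]; exists B.
have [eta eta0 margin] := even_powers_margin r B eps0.
have phi_pos i t : eta * \sum_(l < r.+1) t ^+ (2 * l) <
    \sum_(j < (2 * r).+1) phi j i (y i) * t ^+ j.
  apply: (margin (fun j => phi j i (y i))) => [j jr||u].
  - exact: hB.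
  - have [x hx] := sym_eval_pws (N i) (y i).
    have := h2 x; rewrite !hx; apply.
    by rewrite /ev (@psubst_psum R R idfun); exact: y_sphere.
  - exact: (free_p1_lower_bound eps0 cA hf fE h1).
have [M M0 hM] := cone_local eta0 phi_tame phi_pos.
have fev n X : ev (pws n X) f = \sum_(j < (2 * r).+1) ev (pws n X) (c j) * pws n X 1 ^+ j.
  rewrite fE /ev psubst_sum; apply: eq_bigr => j _.
  by rewrite psubstM psubstX psubst_psum.
have W_cone : cone (fun n => n) (@weight R r) :=
    @cone_weight R nat (fun n => n) r.
have [q hq qE] := cone_spread.
(* The expected penalty is at most [2 / K]. *)
pose K := (Num.bound (4%:R * M / eta)).+1.
have KM : 2 * M / K%:R <= eta / 2.
  have bK : 4%:R * M / eta < K%:R.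
    apply: lt_le_trans (archi_boundP _) _; first by rewrite divr_ge0 ?mulr_ge0 // ltW.
    by rewrite ler_nat.
  rewrite ler_pdivrMr ?ltr0n //; move: bK; rewrite ltr_pdivrMr // => bK.
  lra.
have hS : cone (fun n => n) (fun n X => ev (pws n X) f - eta / 2 * weight r n X
    + M * weight r n X * (K%:R^-1 * spread n X)).
  apply: (@sampling R (fun n X => ev (pws n X) f - eta / 2 * weight r n X)
    (fun n X => M * weight r n X)) => //.
  by apply: cone_ext hM => i X _; rewrite fev.
have h4 : cone (fun n => n) (fun n X => (eta / 2 - 2 * M / K%:R) * weight r n X).
  by apply: (coneZ (c := fun=> eta / 2 - 2 * M / K%:R)) => // n; rewrite subr_ge0.
have h5 : cone (fun n => n) (fun n X => M / K%:R * (weight r n X * q n X)).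
  apply: (coneZ (c := fun=> M / K%:R)) => [n|]; first by rewrite divr_ge0.
  exact: coneM.
apply: cone_ext (coneD hS (coneD h4 h5)) => n X _.
by rewrite qE; field; rewrite pnatr_eq0.
Qed.

End Global.

(** * Homogenization *)

Section Homogenization.
Variable R : realType.

(** By induction on the number of variables, sorting the monomials by their
    exponent at the last one. *)
Lemma mpoly_eq0_points n (p : {mpoly R[n]}) :
  (forall X : nat -> R, p.@[restr X] = 0) -> p = 0.
Proof.
elim: n p => [|n IH] p hp.
  have := hp (fun=> 0); rewrite (nvar0_mpolyC p) mevalC => ->.
  by rewrite mpolyC0.
pose w (i : 'I_n) : 'I_n.+1 := widen_ord (leqnSn n) i.
pose low (m : 'X_{1..n.+1}) : 'X_{1..n} := [multinom m (w i) | i < n].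
have lowI m m' : low m = low m' -> m ord_max = m' ord_max -> m = m'.
  move=> /mnmP hl ho; apply/mnmP => i.
  case: (unliftP ord_max i) => [j ->|->] //.
  have := hl j; rewrite !mnmE (_ : w j = lift ord_max j) //.
  by apply: val_inj; rewrite /= /bump leqNgt ltn_ord.
pose slice k : {mpoly R[n]} := \sum_(m <- msupp p | m ord_max == k) p@_m *: 'X_[low m].
have slice0 k : slice k = 0.
  apply: IH => X.
  pose P : {poly R} := \sum_(m <- msupp p)
    (p@_m * \prod_(i < n) X i ^+ low m i) *: 'X^(m ord_max).
  have P0 : P = 0.
    apply/eqP/negPn/negP => Pn0.
    have /(max_poly_roots Pn0) : all (root P) [seq i%:R | i <- iota 0 (size P)].
      apply/allP => a _; rewrite /root /P horner_sum; apply/eqP.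
      have := hp (fun v => if (v < n)%N then X v else a).
      rewrite mevalE => E; rewrite -[RHS]E; apply: eq_bigr => m _.
      rewrite hornerZ hornerXn -mulrA big_ord_recr /= /restr /= ltnn; congr (_ * (_ * _)).
      by apply: eq_bigr => i _; rewrite mnmE /= ltn_ord.
    rewrite map_inj_uniq ?iota_uniq; last by move=> i j /eqP; rewrite eqr_nat => /eqP.
    by move=> /(_ isT); rewrite size_map size_iota ltnn.
  rewrite /slice raddf_sum /=.
  transitivity P`_k; last by rewrite P0 coef0.
  rewrite /P coef_sum [RHS](bigID (fun m : 'X_{1..n.+1} => m ord_max == k)) /=.
  rewrite [X in _ = _ + X]big1 ?addr0; last first.
    by move=> m /negbTE mk; rewrite coefZ coefXn eq_sym mk mulr0.
  apply: eq_bigr => m /eqP mk.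
  by rewrite mevalZ mevalX coefZ coefXn mk eqxx mulr1.
apply/mpolyP => m; rewrite mcoeff0.
have [mp|mp] := boolP (m \in msupp p); last exact: memN_msupp_eq0.
have := congr1 (mcoeff (low m)) (slice0 (m ord_max)).
rewrite mcoeff0 /slice raddf_sum /= big_mkcond (bigD1_seq m) ?msupp_uniq //=.
rewrite eqxx mcoeffZ mcoeffX eqxx mulr1 big1 ?addr0 // => m' mm'.
case: eqP => // mk; rewrite mcoeffZ mcoeffX.
case: eqP => [/lowI /(_ mk) E|_]; last by rewrite mulr0.
by rewrite E eqxx in mm'.
Qed.

Lemma mevalXn n (p : {mpoly R[n]}) k X : (p ^+ k).@[restr X] = p.@[restr X] ^+ k.
Proof. exact: rmorphXn. Qed.

Lemma is_sosD n (g h : {mpoly R[n]}) : is_sos g -> is_sos h -> is_sos (g + h).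
Proof. by move=> [s ->] [s' ->]; exists (s ++ s'); rewrite big_cat. Qed.

Lemma is_sos_sum n (T : Type) (s : seq T) (G : T -> {mpoly R[n]}) :
  (forall x, is_sos (G x)) -> is_sos (\sum_(x <- s) G x).
Proof.
move=> hG; elim: s => [|x s IH]; first by exists [::]; rewrite !big_nil.
by rewrite big_cons; apply: is_sosD.
Qed.

Lemma is_sos_sq n (g : {mpoly R[n]}) : is_sos (g ^+ 2).
Proof. by exists [:: g]; rewrite big_seq1. Qed.

Lemma is_sosM n (g h : {mpoly R[n]}) : is_sos g -> is_sos h -> is_sos (g * h).
Proof.
move=> [s ->] [s' ->]; rewrite mulr_suml; apply: is_sos_sum => u.
rewrite mulr_sumr; apply: is_sos_sum => v.
by rewrite -exprMn; apply: is_sos_sq.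
Qed.

Lemma is_sos_mpsum2 n k : is_sos (mpsum2 R n ^+ k).
Proof.
elim: k => [|k IH]; first by rewrite expr0 -(expr1n _ 2); apply: is_sos_sq.
rewrite exprS; apply: is_sosM => //; apply: is_sos_sum => v; exact: is_sos_sq.
Qed.

(** For [w = p_2(x)], the points [x / sqrt w] and [- x / sqrt w] lie on the sphere
    and [p] takes the same value at both. Adding the two representations, the
    cross terms of [(E + O) ^+ 2] cancel, and with them the odd powers of
    [sqrt w]. *)
Lemma homogenize n d e (p : {mpoly R[n]}) : (0 < n)%N -> p \is (2 * d).-homog ->
  sphere_sos n e (fun X => p.@[restr X]) -> is_sos (mpsum2 R n ^+ e.+1 * p).
Proof.
move=> n0 hp [s [hs pE]].
pose Q := mpsum2 R n ^+ d * \sum_(q <- s) (q.1 ^+ 2 + mpsum2 R n * q.2 ^+ 2).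
suff -> : mpsum2 R n ^+ e.+1 * p = Q.
  apply: is_sosM; first exact: is_sos_mpsum2.
  apply: is_sos_sum => q; apply: is_sosD; first exact: is_sos_sq.
  by apply: is_sosM; [rewrite -[mpsum2 R n]expr1; exact: is_sos_mpsum2|exact: is_sos_sq].
have mpsum2n0 : mpsum2 R n != 0.
  apply/eqP => /(congr1 (meval (restr (fun v => (v == 0%N)%:R : R)))).
  rewrite meval_mpsum2 meval0 (bigD1 (Ordinal n0)) //= big1 => [|i].
    by rewrite addr0 expr1n => /eqP; rewrite oner_eq0.
  by rewrite -val_eqE /= => /negbTE ->; rewrite expr0n.
apply/eqP; rewrite -subr_eq0; apply/eqP; apply: (mulfI mpsum2n0); rewrite mulr0.
apply: mpoly_eq0_points => X; rewrite mevalM meval_mpsum2; set w := \sum_(v < n) _.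
have [->|wn0] := eqVneq w 0; first by rewrite mul0r.
suff E : w ^+ e.+1 * p.@[restr X] =
    w ^+ d * \sum_(q <- s) (q.1.@[restr X] ^+ 2 + w * q.2.@[restr X] ^+ 2).
  have QE : Q.@[restr X] =
      w ^+ d * \sum_(q <- s) (q.1.@[restr X] ^+ 2 + w * q.2.@[restr X] ^+ 2).
    rewrite /Q mevalM mevalXn meval_mpsum2 raddf_sum /=; congr (_ * _).
    by apply: eq_bigr => q _; rewrite mevalD !mevalXn mevalM mevalXn meval_mpsum2.
  by rewrite mevalB QE mevalM mevalXn meval_mpsum2 E subrr mulr0.
have w0 : 0 < w by rewrite lt_neqAle eq_sym wn0 sumr_ge0 // => v _; exact: sqr_ge0.
pose rho := Num.sqrt w.
have rho2 : rho ^+ 2 = w by rewrite sqr_sqrtr // ltW.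
have on a : a ^+ 2 = w^-1 -> on_sphere n (fun v => a * X v).
  move=> a2; rewrite /on_sphere; under eq_bigr do rewrite exprMn.
  by rewrite -mulr_sumr a2 mulVf.
pose a := rho^-1.
have a2 : a ^+ 2 = w^-1 by rewrite exprVn rho2.
have sq b : b ^+ 2 = w^-1 -> w^-1 ^+ d * p.@[restr X] =
    \sum_(q <- s) (b ^+ e * (b * q.1.@[restr X] + q.2.@[restr X])) ^+ 2.
  move=> b2; rewrite -b2 -exprM -(homog_scale b X hp) pE; last exact: on.
  rewrite !big_seq; apply: eq_bigr => q /hs[h1 h2]; congr (_ ^+ 2).
  by rewrite (homog_scale b X h1) (homog_scale b X h2) exprS; ring.
have E1 := sq a a2; have E2 := sq (- a) (etrans (sqrrN a) a2).
have : 2 * (w^-1 ^+ d * p.@[restr X]) = 2 * (w^-1 ^+ e *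
    \sum_(q <- s) (w^-1 * q.1.@[restr X] ^+ 2 + q.2.@[restr X] ^+ 2)).
  rewrite -[LHS]/((1 + 1) * _) mulrDl !mul1r {1}E1 E2 -big_split !mulr_sumr.
  apply: eq_bigr => q _ /=.
  have sgn : ((- a) ^+ e) ^+ 2 = w^-1 ^+ e by rewrite -exprM mulnC exprM sqrrN a2.
  have sg : (a ^+ e) ^+ 2 = w^-1 ^+ e by rewrite -exprM mulnC exprM a2.
  by rewrite !exprMn sgn sg -a2; ring.
have two0 : (2 : R) != 0 by rewrite pnatr_eq0.
move=> /(mulfI two0) E.
set T := \sum_(q <- s) (w^-1 * _ + _) in E.
have pT : p.@[restr X] = w ^+ d * (w^-1 ^+ e * T).
  by rewrite -E mulrA -exprMn divff // expr1n mul1r.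
have -> : \sum_(q <- s) (q.1.@[restr X] ^+ 2 + w * q.2.@[restr X] ^+ 2) = w * T.
  by rewrite /T mulr_sumr; apply: eq_bigr => q _; rewrite mulrDr mulVKf.
have we : w ^+ e * w^-1 ^+ e = 1 by rewrite -exprMn divff // expr1n.
transitivity ((w ^+ e * w^-1 ^+ e) * (w ^+ d * (w * T))); last by rewrite we mul1r.
by rewrite pT exprSr; ring.
Qed.

End Homogenization.

(** * The theorem *)

Theorem theorem5p4 (R : realType) (d : nat) (eps : R) (f : Lambda R)
    (r : nat) (c : nat -> Lambda R)
    (hd : (0 < d)%N) (heps : 0 < eps)
    (hf : sym_homog (2 * d) f)
    (hA : forall j : nat, (j <= 2 * r)%N -> in_A (2 * d) (c j))
    (hfc : f = \sum_(j < (2 * r).+1) c j * psum R 1 ^+ j)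
    (hlead : c (2 * r)%N <> 0)
    (h1 : forall x : Rinfty R, sym_eval x (psum R 2) = 1 -> eps <= sym_eval x f)
    (h2 : forall x : Rinfty R, sym_eval x (psum R 2) = 1 ->
            eps <= sym_eval x (c (2 * r)%N)) :
  exists k : nat, anydim_sos (psum R 2 ^+ k * f).
Proof.
have [e he] := cone_positive heps hf hA hfc h1 h2.
exists e.+1 => n n0.
have -> : trunc n (psum R 2 ^+ e.+1 * f) = mpsum2 R n ^+ e.+1 * trunc n f.
  by rewrite /trunc psubstM psubstX psubst_psum.
apply: (homogenize n0 (hf n)).
by apply: sphere_sos_ext (he n) => X _; rewrite meval_trunc.
Qed.
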